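(* Let $F$ be a nonarchimedean local field of characteristic $0$ with ring of integers $\mathfrak{g}$, prime ideal $\mathfrak{p}$ and prime element $\pi$. Let $(V,\varphi)$ be a nondegenerate quaternary quadratic space over $F$, $h\in V$ with $\varphi[h]=q\neq0$, $W=(Fh)^{\perp}$ and $\psi=\varphi|_W$. Let $\xi=k_1k_2k_3\in A(W)$ for an orthogonal basis $\{k_i\}$ of $W$, chosen so that $\xi\xi^{*}\in\mathfrak{g}^{\times}\cup\pi\mathfrak{g}^{\times}$, so that $x\mapsto x\xi$ is an isomorphism of $(W,\psi)$ onto $(A^{+}(W)^{\circ},(\xi\xi^{*})^{-1}\nu^{\circ})$. Let $\delta=\det(\varphi)$, $K=F(\sqrt{\delta})$ the discriminant field of $\varphi$, and write $\delta q\mathfrak{g}=\mathfrak{a}\mathfrak{b}^{2}$ with $\mathfrak{a}\in\{\mathfrak{g},\mathfrak{p}\}$ and a fractional ideal $\mathfrak{b}$. Then for every $\mathfrak{g}$-maximal lattice $L$ in $V$ with respect to $\varphi$, $$(L\cap W)\xi=\mathfrak{c}\,[M/L\cap W]\,\bigl(A^{+}(L\cap W)\widetilde{\ }\cap A^{+}(W)^{\circ}\bigr),$$ where $\mathfrak{c}=\mathfrak{a}$ if $A^{+}(W)\cong M_{2}(F)$ and $\mathfrak{c}=\mathfrak{p}$ otherwise, and $M$ is any $\mathfrak{g}$-maximal lattice in $W$ with respect to $\psi$.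
   Context: $\varphi[x]=\varphi(x,x)$; $\det(\varphi)$ is the determinant of a Gram matrix (defined up to squares). A $\mathfrak{g}$-lattice is a finitely generated $\mathfrak{g}$-submodule containing a basis; integral if $\varphi[L]\subset\mathfrak{g}$; $\mathfrak{g}$-maximal if maximal among lattices with all $\varphi[x]\in\mathfrak{g}$. $[L/L']$ is the ideal generated by $\det\alpha$ over $F$-linear automorphisms $\alpha$ with $L\alpha\subset L'$. $A(W)$ is the Clifford algebra of $\psi$, $A^{+}(W)$ the even Clifford algebra (a quaternion algebra), $*$ the canonical involution; $A^{+}(W)^{\circ}=\{x:x^*=-x\}$; $\nu[y]=yy^*$, $\nu(x,y)=2^{-1}(xy^*+yx^* )$, $\nu^\circ=\nu|_{A^+(W)^\circ}$. For an integral lattice $N\subset W$, $A^{+}(N)=A^{+}(W)\cap A(N)$ where $A(N)$ is the subring generated by $\mathfrak{g}$ and $N$; for an order $\mathfrak{o}$, $\mathfrak{o}\widetilde{\ }=\{x\in A^{+}(W):2\nu(x,\mathfrak{o})\subset\mathfrak{g}\}$. *)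

(* Defs.v *)
From mathcomp Require Import all_boot all_order all_algebra.
From mathcomp Require Import all_classical.

Set Implicit Arguments.
Unset Strict Implicit.
Unset Printing Implicit Defensive.

Import Order.TTheory GRing.Theory Num.Theory.

Local Open Scope classical_set_scope.
Local Open Scope ring_scope.

Section LocalField.
Variables (F : fieldType) (v : F -> int).

(* The valuation of 0 is +oo; the value [v 0] is never used. *)
Definition vge (n : int) (x : F) : Prop := x != 0 -> n <= v x.

(* [v] is the normalized discrete valuation; [lf_residue] says that finitely
   many elements represent all residue classes modulo the prime ideal. *)
Record local_field : Prop := LocalField {
  lf_normalized : exists2 x, x != 0 & v x = 1;
  lf_mul : forall x y, x != 0 -> y != 0 -> v (x * y) = v x + v y;
  lf_add : forall n x y, vge n x -> vge n y -> vge n (x + y);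
  lf_complete : forall u : nat -> F,
    (forall n, exists N, forall i j, (N <= i)%N -> (N <= j)%N ->
       vge n (u i - u j)) ->
    exists l, forall n, exists N, forall i, (N <= i)%N -> vge n (u i - l);
  lf_residue : exists s : seq F, forall x, vge 0 x ->
    exists2 y, y \in s & vge 1 (x - y)
}.

Definition integers : set F := [set x | vge 0 x].

Definition prime_ideal : set F := [set x | vge 1 x].

Definition integer_units : set F :=
  [set x | [/\ integers x, x != 0 & integers x^-1]].

Definition prime_element (pi : F) : Prop := pi != 0 /\ v pi = 1.

End LocalField.

Section Modules.
Variables (F : fieldType) (g : set F).

Definition gsubmodule (U : lmodType F) (M : set U) : Prop :=
  [/\ M 0, forall x y, M x -> M y -> M (x + y)
    & forall a x, g a -> M x -> M (a *: x)].

Definition gspan (U : lmodType F) (X : set U) : set U :=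
  smallest (@gsubmodule U) X.

Definition fg_gsubmodule (U : lmodType F) (M : set U) : Prop :=
  exists s : seq U, M = gspan [set x | x \in s].

Definition fractional_ideal (I : set F) : Prop :=
  @fg_gsubmodule F^o I /\ exists2 x, I x & x != 0.

Definition gmul (U : lmodType F) (I : set F) (X : set U) : set U :=
  gspan [set a *: x | a in I & x in X].

Definition ideal_mul (I J : set F) : set F := @gmul F^o I J.

Definition lattice (U : vectType F) (L : set U) : Prop :=
  fg_gsubmodule L /\
  exists2 X : seq U, basis_of {:U} X & forall x, x \in X -> L x.

Definition integral_lattice (U : vectType F) (f : U -> U -> F) (L : set U) :
    Prop :=
  lattice L /\ forall x, L x -> g (f x x).

Definition maximal_lattice (U : vectType F) (f : U -> U -> F) (L : set U) :
    Prop :=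
  integral_lattice f L /\
  forall L', integral_lattice f L' -> L `<=` L' -> L' = L.

Definition lfun_det (U : vectType F) (a : 'End(U)) : F :=
  \det (passmx.mxof (vbasis {:U}) (vbasis {:U}) a).

(* The ideal [L / L']. *)
Definition lattice_index (U : vectType F) (L L' : set U) : set F :=
  @gspan F^o [set lfun_det a | a in
    [set a : 'End(U) | lker a = 0%VS /\ (forall x, L x -> L' (a x))]].

End Modules.

Definition gram_det (F : fieldType) (U : vectType F) (f : U -> U -> F)
    (n : nat) (e : n.-tuple U) : F :=
  \det (\matrix_(i < n, j < n) f (tnth e i) (tnth e j)).

Definition restr_form (F : fieldType) (V : vectType F) (f : V -> V -> F)
    (W : {vspace V}) : subvs_of W -> subvs_of W -> F :=
  fun x y => f (vsval x) (vsval y).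
Arguments restr_form {F V} f W x y.

Section Clifford.
Variables (F : fieldType) (U : vectType F) (f : U -> U -> F).

(* Clifford algebra of f, by its universal property; iota is the inclusion of
   U, with the normalization x ^ 2 = f(x, x). *)
Definition is_clifford_algebra (A : algType F) (iota : {linear U -> A}) :
    Prop :=
  (forall x, iota x * iota x = (f x x)%:A) /\
  forall (B : algType F) (j : {linear U -> B}),
    (forall x, j x * j x = (f x x)%:A) ->
    exists2 m : {lrmorphism A -> B}, (forall x, m (iota x) = j x) &
      forall m' : {lrmorphism A -> B}, (forall x, m' (iota x) = j x) ->
        m' =1 m.

Variables (A : algType F) (iota : {linear U -> A}).

(* The sign convention is that * fixes U pointwise. *)
Record canonical_involution (star : {linear A -> A}) : Prop :=
  CanonicalInvolution {
    star_mul : forall x y, star (x * y) = star y * star x;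
    star_invol : involutive star;
    star_iota : forall x, star (iota x) = iota x
  }.

(* Taking gspan over all of F gives the F-linear span. *)
Definition even_clifford : set A :=
  gspan setT
    [set \prod_(x <- s) iota x | s in [set s : seq U | ~~ odd (size s)]].

Definition even_clifford_split : Prop :=
  exists2 m : {lrmorphism 'M[F]_2 -> A}, injective m & range m = even_clifford.

Definition subring (S : set A) : Prop :=
  [/\ S 1, forall x y, S x -> S y -> S (x - y)
    & forall x y, S x -> S y -> S (x * y)].

Variable g : set F.

Definition clifford_order (N : set U) : set A :=
  smallest subring ([set a%:A | a in g] `|` iota @` N).

Definition even_clifford_order (N : set U) : set A :=
  even_clifford `&` clifford_order N.

Variable star : {linear A -> A}.

Definition pure_even : set A := [set x | even_clifford x /\ star x = - x].

(* nu takes values in the scalars F%:A when restricted to even_clifford. *)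
Definition nu (x y : A) : A := 2%:R^-1 *: (x * star y + y * star x).

Definition order_dual (o : set A) : set A :=
  [set x | even_clifford x /\
    forall y, o y -> exists2 c : F, g c & 2%:R *: nu x y = c%:A].

End Clifford.

(* Main.v *)
(** Write Q[w] = psi[w], N = L \cap W, c0 = xi xi^*, and let D(e) be the
    determinant of a triple e of vectors of W in the coordinates k1, k2, k3.
    For w, x, y in W one has 2 nu(w xi, x y) = 2 c0 D(w, x, y), so for a g-basis
    e of N the pure part of A^+(N)~ is (2 c0 D(e))^-1 N xi. As [M/N] is
    generated by D(e) / D(m), m a g-basis of M, the claim no longer involves L:
    it says v(d(M)) + v(c0) = 2 v(c), where d(M) = 4 c0 D(m)^2 is the
    half-discriminant of M, and v(a) = v(c0) because delta q is c0 times a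
    square. Since v(d(M)) and v(c0) have the same parity and v(c0) is 0 or 1, it
    is enough that v(d(M)) is 0 or 1 when psi is isotropic (M is a hyperbolic
    plane plus a line) and 1 or 2 when it is anisotropic. In the latter case
    Q mod p on M/M1 and Q/pi mod p on M1/pi M, with M1 = {x in M : Q[x] in p},
    are anisotropic over a finite field, hence of dimensions (2,1) or (1,2).
    Finally A^+(W) is split exactly when psi is isotropic: a nilpotent matrix
    is some w xi with Q[w] = 0, and a hyperbolic pair gives matrix units. *)

(* Residue characteristic 2 shapes the proof: a lattice then need not have an orthogonal basis, and
   psi(x, y) need not be integral on it. So integrality is tested on Q[x] and 2 psi(x, y), residue
   forms keep their cross terms, and the half-discriminant is used because it is a polynomial with
   integer coefficients in those values. Only the space W is treated in the orthogonal frame k1, k2,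
   k3. In the anisotropic case Hensel's lemma gives v(2 psi(x, y)) >= (v(Q[x]) + v(Q[y])) / 2.
   Whether w / pi can be adjoined to M thus depends on Q[w] alone, and the residue dimensions are
   limited by Chevalley's theorem that a ternary quadratic form over a finite field has a nontrivial
   zero. The Clifford algebra is known by its universal property alone. Scalars and pure quaternions
   are shown independent by means of star, and even elements are told from odd ones by the
   automorphism extending w -> -w. *)
From HB Require Import structures.
Require Import Defs.
From mathcomp Require Import all_boot all_order all_algebra.
From mathcomp Require Import all_classical.
From mathcomp Require Import zify ring.

Set Implicit Arguments.
Unset Strict Implicit.
Unset Printing Implicit Defensive.

Import Order.TTheory GRing.Theory Num.Theory.
Local Open Scope classical_set_scope.
Local Open Scope ring_scope.

(** * Valuations *)

Section Valuation.
Variables (F : fieldType) (v : F -> int).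
Hypothesis HF : local_field v.

Lemma vM (x y : F) : x != 0 -> y != 0 -> v (x * y) = v x + v y.
Proof. by case: HF => _ H _ _ _; apply: H. Qed.

Lemma v1 : v 1 = 0.
Proof.
have e : v (1 * 1) = v 1 + v 1 by rewrite vM ?oner_neq0.
by move: e; rewrite mulr1; lia.
Qed.

Lemma vV (x : F) : x != 0 -> v x^-1 = - v x.
Proof.
move=> x0; have := vM x0 (invr_neq0 x0); rewrite mulfV // v1; lia.
Qed.

Lemma vN (x : F) : v (- x) = v x.
Proof.
have n1 : -1 != 0 :> F by rewrite oppr_eq0 oner_eq0.
have vn1 : v (-1) = 0 by have := vM n1 n1; rewrite mulrNN mulr1 v1 => e; lia.
have [->|x0] := eqVneq x 0; first by rewrite oppr0.
by rewrite -mulN1r vM // vn1 add0r.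
Qed.

Lemma vX2 (x : F) : x != 0 -> v (x ^+ 2) = 2 * v x.
Proof. by move=> x0; rewrite expr2 vM //; lia. Qed.

Lemma vge0 n : vge v n 0.
Proof. by rewrite /vge eqxx. Qed.

Lemma vge_v (x : F) : vge v (v x) x.
Proof. by move=> _. Qed.

Lemma vgeD n x y : vge v n x -> vge v n y -> vge v n (x + y).
Proof. by case: HF => _ _ H _ _; apply: H. Qed.

Lemma vgeN n x : vge v n x -> vge v n (- x).
Proof. by rewrite /vge oppr_eq0 vN. Qed.

Lemma vgeB n x y : vge v n x -> vge v n y -> vge v n (x - y).
Proof. by move=> hx hy; apply: vgeD => //; apply: vgeN. Qed.

Lemma vgeM n m x y : vge v n x -> vge v m y -> vge v (n + m) (x * y).
Proof.
move=> hx hy; rewrite /vge mulf_eq0 negb_or => /andP[x0 y0].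
by rewrite vM // lerD ?hx ?hy.
Qed.

Lemma vge_le n m x : m <= n -> vge v n x -> vge v m x.
Proof. by move=> le hx x0; apply: le_trans (hx x0). Qed.

Lemma vgeMl n x y : vge v 0 x -> vge v n y -> vge v n (x * y).
Proof. by move=> hx hy; have := vgeM hx hy; rewrite add0r. Qed.

Lemma vgeMr n x y : vge v n x -> vge v 0 y -> vge v n (x * y).
Proof. by move=> hx hy; rewrite mulrC; apply: vgeMl. Qed.

Lemma vge_1 : vge v 0 1.
Proof. by move=> _; rewrite v1. Qed.

Lemma vge_nat n : vge v 0 n%:R.
Proof.
elim: n => [|n IH]; first exact: vge0.
by rewrite -natr1; apply: vgeD => //; apply: vge_1.
Qed.

Lemma vgeX2 n x : vge v n x -> vge v (n + n) (x ^+ 2).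
Proof. by move=> h; rewrite expr2; apply: vgeM. Qed.

Lemma vgeX2_0 x : vge v 0 x -> vge v 0 (x ^+ 2).
Proof. by move/vgeX2. Qed.

Lemma vge_mulP n x y : x != 0 -> vge v (n + v x) (x * y) <-> vge v n y.
Proof.
move=> x0; split=> [h y0|h]; last by rewrite addrC; apply: vgeM.
by have := h; rewrite /vge mulf_neq0 // vM // => /(_ isT); lia.
Qed.

Lemma vge_Vl n x y : x != 0 -> vge v n y -> vge v (n - v x) (x^-1 * y).
Proof. by move=> x0 h; rewrite addrC -vV //; apply: vgeM. Qed.

Lemma v_eq (n : int) (x : F) : vge v n x -> ~ vge v (n + 1) x ->
  x != 0 /\ v x = n.
Proof.
move=> h1 h2; have x0 : x != 0.
  by apply/eqP => e; apply: h2; rewrite e; apply: vge0.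
by split=> //; have := h1 x0; case: (ltrP n (v x)) => [lt|]; last lia;
  case: h2 => _; lia.
Qed.

Lemma vge_eqP (n : int) (x : F) : x != 0 -> vge v n x <-> n <= v x.
Proof. by move=> x0; split=> [/(_ x0)|h _]. Qed.

Lemma vB_eq (x y : F) :
  x != 0 -> vge v (v x + 1) (x - y) -> y != 0 /\ v y = v x.
Proof.
move=> x0 h; apply: v_eq.
  have -> : y = x - (x - y) by ring.
  by apply: vgeB => //; apply: vge_le h; lia.
move=> hy; have hx : vge v (v x + 1) x.
  have {2}-> : x = (x - y) + y by ring.
  exact: vgeD.
by have := hx x0; lia.
Qed.

Lemma v_unit_of_not_p x : vge v 0 x -> ~ vge v 1 x -> x != 0 /\ v x = 0.
Proof. by move=> h1 h2; apply: v_eq => //; rewrite add0r. Qed.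

Lemma unit_not_p (x : F) : x != 0 -> v x = 0 -> ~ vge v 1 x.
Proof. by move=> x0 vx h; have := h x0; lia. Qed.

Lemma p_prime x y : vge v 0 x -> vge v 0 y -> vge v 1 (x * y) ->
  vge v 1 x \/ vge v 1 y.
Proof.
move=> hx hy h; have [|nx] := EM (vge v 1 x); first by left.
right; have [x0 vx] := v_unit_of_not_p hx nx.
by apply/(vge_mulP 1 y x0); rewrite vx addr0.
Qed.

Lemma p_X2 x : vge v 0 x -> vge v 1 (x ^+ 2) -> vge v 1 x.
Proof. by move=> h /(p_prime h h)[]. Qed.

Section Uniformizer.
Variable pi : F.
Hypothesis Hpi : prime_element v pi.

Lemma pi_neq0 : pi != 0. Proof. by case: Hpi. Qed.

Lemma v_pi : v pi = 1. Proof. by case: Hpi. Qed.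

Lemma v_piX n : v (pi ^+ n) = n.
Proof.
elim: n => [|n IH]; first by rewrite expr0 v1.
by rewrite exprS vM ?expf_neq0 ?pi_neq0 // IH v_pi; lia.
Qed.

Lemma vge_div_pi n x : vge v (n + 1) x -> vge v n (pi^-1 * x).
Proof.
move=> h; have := vge_Vl pi_neq0 h; rewrite v_pi; apply: vge_le; lia.
Qed.

Lemma vge_mul_pi n x : vge v n x -> vge v (n + 1) (pi * x).
Proof. by move=> h; rewrite addrC -v_pi; apply: vgeM. Qed.

Lemma exists_v n : exists2 x : F, x != 0 & v x = n.
Proof.
case: n => n; first by exists (pi ^+ n); rewrite ?expf_neq0 ?pi_neq0 // v_piX.
exists (pi ^+ n.+1)^-1; first by rewrite invr_neq0 // expf_neq0 // pi_neq0.
by rewrite vV ?expf_neq0 ?pi_neq0 // v_piX; lia.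
Qed.

End Uniformizer.

End Valuation.

Arguments vge_nat {F v} HF n.

(** * Quadratic forms over the residue field *)

Section Residue.
Variables (F : fieldType) (v : F -> int).
Hypothesis HF : local_field v.

(* A class is encoded by the set of positions of its members in a fixed list
   of representatives. *)
Lemma residue_system : exists (T : finType) (rep : T -> F) (cls : F -> T),
  [/\ forall t, vge v 0 (rep t), cancel rep cls &
      forall x y, vge v 0 x -> vge v 0 y -> cls x = cls y <-> vge v 1 (x - y)].
Proof.
have [_ _ _ _ [s Hs]] := HF.
pose k x := [set i : 'I_(size s) | `[< vge v 1 (x - s`_i) >]]%SET.
have kP x y : vge v 0 x -> k x = k y <-> vge v 1 (x - y).
  move=> hx; split=> [e|h].
    have [z zs hz] := Hs x hx.
    have lt : (index z s < size s)%N by rewrite index_mem.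
    have : Ordinal lt \in k x by rewrite inE /= nth_index //; apply/asboolP.
    rewrite e inE /= nth_index // => /asboolP hz'.
    have -> : x - y = (x - z) - (y - z) by ring.
    exact: (vgeB HF).
  apply/setP => i; rewrite !inE; apply/asboolP/asboolP => h'.
    have -> : y - s`_i = (x - s`_i) - (x - y) by ring.
    exact: (vgeB HF).
  have -> : x - s`_i = (y - s`_i) + (x - y) by ring.
  exact: (vgeD HF).
pose P t := `[< exists2 x, vge v 0 x & k x = t >].
have P0 : P (k 0) by apply/asboolP; exists 0 => //; apply: vge0.
have kPP x : vge v 0 x -> P (k x) by move=> hx; apply/asboolP; exists x.
pose T : finType := {t | P t}.
have repP (t : T) : exists x, vge v 0 x /\ k x = val t.
  by have /asboolP[x hx e] := valP t; exists x.
pose rep t := projT1 (cid (repP t)).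
have rep0 t : vge v 0 (rep t) by rewrite /rep; case: cid => x /= [].
have repk t : k (rep t) = val t by rewrite /rep; case: cid => x /= [].
(* For integral [x] the predicate [P] holds, so the default of [insubd] is not reached there. *)
pose cls x : T := insubd (exist _ (k 0) P0) (k x).
have vcls x : vge v 0 x -> val (cls x) = k x.
  by move=> hx; rewrite val_insubd kPP.
exists T, rep, cls; split=> // [t|x y hx hy].
  by apply: val_inj; rewrite vcls.
rewrite -(kP x y hx) -!vcls //; split=> [->//|]; exact: val_inj.
Qed.

(** In residue characteristic 2 squaring is additive modulo p, hence injective on the residue field,
    hence surjective by finiteness. *)
Lemma square_mod_p : vge v 1 2%:R -> forall x, vge v 0 x ->
  exists2 y, vge v 0 y & vge v 1 (y ^+ 2 - x).
Proof.
move=> p2 x hx; have [T [rep [cls [rep0 repK clsP]]]] := residue_system.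
pose sq t := cls (rep t ^+ 2).
have sq_inj : injective sq.
  move=> t u /clsP-/(_ (vgeX2_0 HF (rep0 t)) (vgeX2_0 HF (rep0 u))) h.
  rewrite -[t]repK -[u]repK; apply/clsP => //.
  apply: (p_X2 HF); first exact: (vgeB HF).
  have -> : (rep t - rep u) ^+ 2 =
    (rep t ^+ 2 - rep u ^+ 2) + 2%:R * (rep u * (rep u - rep t)) by ring.
  apply: (vgeD HF h); apply: (vgeMr HF p2); apply: (vgeMl HF) => //.
  exact: (vgeB HF).
have [g _ gK] := injF_bij sq_inj.
exists (rep (g (cls x))) => //; apply/clsP => //; first exact: (vgeX2_0 HF).
exact: gK.
Qed.

(** Modulo p only x and -x can share a value of a x^2 + f, and 0 shares its value with no other
    class, so the values fill more than half of the residue field. *)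
Lemma card_imset_square (T : finType) (rep : T -> F) (cls : F -> T) (a f : F) :
  (forall t, vge v 0 (rep t)) -> cancel rep cls ->
  (forall x y, vge v 0 x -> vge v 0 y -> cls x = cls y <-> vge v 1 (x - y)) ->
  ~ vge v 1 2%:R -> vge v 0 a -> ~ vge v 1 a -> vge v 0 f ->
  (#|T| < 2 * #|[set cls (a * rep t ^+ 2 + f)%R | t in T]%SET|)%N.
Proof.
move=> rep0 repK clsP np2 ha npa hf.
pose sq t := cls (a * rep t ^+ 2 + f).
have sq0 t : vge v 0 (a * rep t ^+ 2 + f).
  by apply: (vgeD HF) => //; apply: (vgeMl HF) => //; apply: (vgeX2_0 HF).
have sqE t u : sq t = sq u -> t = u \/ t = cls (- rep u).
  move=> /clsP-/(_ (sq0 t) (sq0 u)) h.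
  have hm : vge v 0 (rep t - rep u) by apply: (vgeB HF).
  have hp : vge v 0 (rep t + rep u) by apply: (vgeD HF).
  have h2 : vge v 1 (a * ((rep t - rep u) * (rep t + rep u))).
    by move: h; congr (vge v 1 _); ring.
  have [//|h3] := p_prime HF ha (vgeMl HF hm hp) h2.
  have [{}h|{}h] := p_prime HF hm hp h3; [left|right].
    by rewrite -[t]repK -[u]repK; apply/clsP.
  rewrite -[t]repK; apply/clsP; rewrite ?opprK //; exact: (vgeN HF).
pose z := cls 0; pose A := [set~ z]%SET.
have zin : sq z \notin [set sq t | t in A]%SET.
  apply/imsetP => -[t]; rewrite !inE => /eqP tz.
  have hz : vge v 1 (rep z).
    by rewrite -[rep z]subr0; apply/clsP; rewrite ?repK //; apply: vge0.
  case/sqE => [|e]; first by move/esym.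
  apply: tz; rewrite -[t]repK; apply/clsP => //; first exact: vge0.
  rewrite subr0 -[rep t]opprK; apply: (vgeN HF).
  have : z = cls (rep z) by rewrite repK.
  rewrite e => /clsP-/(_ (vgeN HF (rep0 t)) (rep0 _)) h.
  have -> : - rep t = (- rep t - rep (cls (- rep t))) + rep (cls (- rep t)).
    by ring.
  by apply: (vgeD HF) => //; rewrite -e.
have cA : (#|A| <= 2 * #|[set sq t | t in A]%SET|)%N.
  rewrite -sum1_card (partition_big_imset sq) /= mulnC -sum_nat_const.
  apply: leq_sum => _ /imsetP[u _ ->]; rewrite sum1dep_card.
  apply: leq_trans (_ : #|[set u; cls (- rep u)%R]%SET| <= 2)%N.
    apply: subset_leq_card; apply/fintype.subsetP => t.
    rewrite !inE => /andP[_ /eqP].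
    by case/sqE => ->; rewrite eqxx ?orbT.
  by rewrite cards2; case: eqP.
have := cardsC1 z; rewrite -/A => eA.
have sub : sq z |: [set sq t | t in A]%SET \subset [set sq t | t in T]%SET.
  by apply/fintype.subsetP => u; rewrite inE => /orP[/set1P ->|/imsetP[t _ ->]];
    apply: imset_f.
have := subset_leq_card sub; rewrite cardsU1 zin -/sq.
have : (0 < #|T|)%N by [apply/card_gt0P; exists z].
move: cA eA; set n1 := #|A|; set n2 := #|imset sq (mem A)|.
by set n3 := #|imset sq _|; set n4 := #|T|; lia.
Qed.

(** Pigeonhole: the values of a x^2 + f and those of -d y^2 each fill more than half of the residue
    field, so they meet. *)
Lemma binary_diag_universal (a d f : F) : ~ vge v 1 2%:R ->
  vge v 0 a -> ~ vge v 1 a -> vge v 0 d -> ~ vge v 1 d -> vge v 0 f ->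
  exists x y, [/\ vge v 0 x, vge v 0 y & vge v 1 (a * x ^+ 2 + d * y ^+ 2 + f)].
Proof.
move=> np2 ha npa hd npd hf.
have [T [rep [cls [rep0 repK clsP]]]] := residue_system.
have hd' : vge v 0 (- d) by apply: (vgeN HF).
have npd' : ~ vge v 1 (- d) by move/(vgeN HF); rewrite opprK.
have cA := card_imset_square rep0 repK clsP np2 ha npa hf.
have cB := card_imset_square rep0 repK clsP np2 hd' npd' (vge0 v 0).
set SA := imset _ _ in cA; set SB := imset _ _ in cB.
have : ~~ [disjoint SA & SB].
  apply/negP => dis; have := max_card (mem (SA :|: SB)%SET).
  by have := (leq_card_setU SA SB).2; rewrite dis => /eqP ->; lia.
case/pred0Pn => _ /andP[/imsetP[t _ ->] /imsetP[u _ /clsP h]].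
exists (rep t), (rep u); split=> //.
have {h} := h _ _; rewrite addr0 => h.
have -> : a * rep t ^+ 2 + d * rep u ^+ 2 + f =
  a * rep t ^+ 2 + f - - d * rep u ^+ 2 by ring.
apply: h; last by apply: (vgeMl HF) => //; apply: (vgeX2_0 HF).
by apply: (vgeD HF) => //; apply: (vgeMl HF) => //; apply: (vgeX2_0 HF).
Qed.

End Residue.

Ltac vint HF :=
  repeat first [assumption | apply: (vge_1 HF) | apply: (vge_nat HF)
    | apply: vge0 | apply: (vgeD HF) | apply: (vgeN HF) | apply: (vgeX2_0 HF)
    | apply: (vgeMl HF)].

Section ResidueForms.
Variables (F : fieldType) (v : F -> int).
Hypothesis HF : local_field v.

Lemma vge0_inv x : vge v 0 x -> ~ vge v 1 x -> vge v 0 x^-1.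
Proof.
by move=> h1 h2 _; have [x0 vx] := v_unit_of_not_p h1 h2; rewrite (vV HF) // vx.
Qed.

(** A discriminant in p would produce a zero. If 2 is in p, then so is b, and a x^2 + d vanishes
    modulo p at a square root of -d/a; if 2 is a unit, the vector (-b, 2a) has value a (4 a d -
    b^2). *)
Lemma binary_disc_unit a b d : vge v 0 a -> vge v 0 b -> vge v 0 d ->
  (forall x y, vge v 0 x -> vge v 0 y ->
     vge v 1 (a * x ^+ 2 + b * x * y + d * y ^+ 2) -> vge v 1 x /\ vge v 1 y) ->
  ~ vge v 1 (4%:R * a * d - b ^+ 2).
Proof.
move=> ha hb hd aniso hD.
have npa : ~ vge v 1 a.
  move=> pa; case: (aniso 1 0) => [|||]; try by vint HF.
    by rewrite expr0n /= mulr0 addr0 mulr0 addr0 expr1n mulr1.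
  by move=> h _; apply: (unit_not_p (oner_neq0 F) (v1 HF)).
have [a0 _] := v_unit_of_not_p ha npa.
have [p2|np2] := EM (vge v 1 2%:R).
  have pb : vge v 1 b.
    apply: (p_X2 HF hb).
    have -> : b ^+ 2 = 2%:R * (2%:R * a * d) - (4%:R * a * d - b ^+ 2) by ring.
    by apply: (vgeB HF) => //; apply: (vgeMr HF p2); vint HF.
  have hda : vge v 0 (- d / a) by vint HF; apply: vge0_inv.
  have [x hx h] := square_mod_p HF p2 hda.
  case: (aniso x 1) => [|||_]; try by vint HF.
    have -> : a * x ^+ 2 + b * x * 1 + d * 1 ^+ 2 =
      a * (x ^+ 2 - - d / a) + b * x by field.
    by apply: (vgeD HF); [apply: (vgeMl HF)|apply: (vgeMr HF)].
  exact: (unit_not_p (oner_neq0 F) (v1 HF)).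
case: (aniso (- b) (2%:R * a)) => [|||_]; try by vint HF.
  have -> : a * (- b) ^+ 2 + b * - b * (2%:R * a) + d * (2%:R * a) ^+ 2 =
    a * (4%:R * a * d - b ^+ 2) by ring.
  exact: (vgeMl HF).
by move=> h; case: (p_prime HF (vge_nat HF 2) ha h).
Qed.

(** If 2 is in p, then y = 0 and a square root of -f/a modulo p suffice; otherwise completing the
    square reduces to the diagonal case. *)
Lemma binary_universal a b d f : vge v 0 a -> ~ vge v 1 a -> vge v 0 b ->
  vge v 0 d -> ~ vge v 1 (4%:R * a * d - b ^+ 2) -> vge v 0 f ->
  exists x y, [/\ vge v 0 x, vge v 0 y &
    vge v 1 (a * x ^+ 2 + b * x * y + d * y ^+ 2 + f)].
Proof.
move=> ha npa hb hd hD hf.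
have [a0 _] := v_unit_of_not_p ha npa; have hai := vge0_inv ha npa.
have [p2|np2] := EM (vge v 1 2%:R).
  have [x hx h] := square_mod_p HF p2 (vgeMl HF (vgeN HF hf) hai).
  exists x, 0; split=> //; first exact: vge0.
  have -> : a * x ^+ 2 + b * x * 0 + d * 0 ^+ 2 + f = a * (x ^+ 2 - - f / a).
    by field.
  exact: (vgeMl HF).
have [t0 _] := v_unit_of_not_p (vge_nat HF 2) np2.
have hti := vge0_inv (vge_nat HF 2) np2.
(* The coefficient of y^2 left after completing the square in x. *)
pose d' := (4%:R * a * d - b ^+ 2) / (2%:R * 2%:R * a).
have hd' : vge v 0 d' by rewrite /d' !invfM; vint HF.
have npd' : ~ vge v 1 d'.
  move=> pd'; apply: hD.
  have -> : 4%:R * a * d - b ^+ 2 = d' * (2%:R * 2%:R * a).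
    by rewrite /d' divfK // !mulf_neq0.
  by apply: (vgeMr HF) => //; vint HF.
have [x [y [hx hy h]]] := binary_diag_universal HF np2 ha npa hd' npd' hf.
exists (x - b * y / (2%:R * a)), y; split=> //.
  by rewrite invfM; vint HF.
move: h; congr (vge v 1 _); rewrite /d'.
field.
by rewrite a0 t0 (natrM F 2 2) mulf_neq0.
Qed.

(** Chevalley's theorem for ternary forms. If the part in x and y is anisotropic modulo p, its
    discriminant is a unit, so a translation removes the cross terms with z, and [binary_universal]
    gives a zero with z = 1. *)
Lemma ternary_isotropic_mod_p a b c d e f :
  vge v 0 a -> vge v 0 b -> vge v 0 c -> vge v 0 d -> vge v 0 e -> vge v 0 f ->
  exists x y z, [/\ vge v 0 x, vge v 0 y, vge v 0 z,
    ~ [/\ vge v 1 x, vge v 1 y & vge v 1 z] &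
    vge v 1 (a * x ^+ 2 + d * y ^+ 2 + f * z ^+ 2
             + b * x * y + c * x * z + e * y * z)].
Proof.
move=> ha hb hc hd he hf; apply: contrapT => none.
have aniso x y : vge v 0 x -> vge v 0 y ->
    vge v 1 (a * x ^+ 2 + b * x * y + d * y ^+ 2) -> vge v 1 x /\ vge v 1 y.
  move=> hx hy h; apply: contrapT => nxy; apply: none.
  exists x, y, 0; split=> //; first exact: vge0.
    by case=> px py _; apply: nxy.
  by move: h; congr (vge v 1 _); ring.
have hD := binary_disc_unit ha hb hd aniso.
have npa : ~ vge v 1 a.
  move=> pa; case: (aniso 1 0) => [|||]; try by vint HF.
    by rewrite expr0n /= mulr0 addr0 mulr0 addr0 expr1n mulr1.
  by move=> h _; apply: (unit_not_p (oner_neq0 F) (v1 HF)).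
have hD0 : vge v 0 (4%:R * a * d - b ^+ 2) by vint HF.
have [D0 _] := v_unit_of_not_p hD0 hD; have hDi := vge0_inv hD0 hD.
set D := _ - _ in hD hD0 D0 hDi.
(* The point at which both partial derivatives in x and y vanish when z = 1. *)
pose x0 := (b * e - 2%:R * d * c) / D; pose y0 := (b * c - 2%:R * a * e) / D.
have hx0 : vge v 0 x0 by rewrite /x0; vint HF.
have hy0 : vge v 0 y0 by rewrite /y0; vint HF.
pose f' := a * x0 ^+ 2 + d * y0 ^+ 2 + f + b * x0 * y0 + c * x0 + e * y0.
have hf' : vge v 0 f' by rewrite /f'; vint HF.
have [x [y [hx hy h]]] := binary_universal ha npa hb hd hD hf'.
apply: none; exists (x + x0), (y + y0), 1; split; try by vint HF.
  by case=> _ _; apply: (unit_not_p (oner_neq0 F) (v1 HF)).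
move: h; congr (vge v 1 _); rewrite /f' /x0 /y0 /D.
by field.
Qed.

End ResidueForms.

(** * Quadratic equations *)

Section Hensel.
Variables (F : fieldType) (v : F -> int).
Hypothesis HF : local_field v.

Lemma vge_all_eq0 x : (forall n : nat, vge v n x) -> x = 0.
Proof.
move=> h; apply/eqP/negP => /negP x0; have := h `|v x|.+1 x0; lia.
Qed.

(** Since m lies in p, the map u -> 1 + m u^2 contracts the ring of integers, whatever the residue
    characteristic. *)
Lemma quadratic_fixpoint m : vge v 1 m -> exists s, s = 1 + m * s ^+ 2.
Proof.
move=> hm; have hm0 : vge v 0 m by apply: vge_le hm.
pose u := fix u n := if n is n'.+1 then 1 + m * u n' ^+ 2 else 1.
have uS n : u n.+1 = 1 + m * u n ^+ 2 by [].
have u0 n : vge v 0 (u n) by elim: n => [|n IH]; rewrite ?uS; vint HF.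
have step (n : nat) : vge v n%:Z (u n.+1 - u n).
  elim: n => [|n IH]; first by vint HF.
  have -> : u n.+2 - u n.+1 = m * ((u n.+1 - u n) * (u n.+1 + u n)).
    by rewrite (uS n.+1) [in X in _ - X = _]uS; ring.
  have -> : n.+1%:Z = 1 + n%:Z by lia.
  by apply: (vgeM HF hm); apply: (vgeMr HF IH); vint HF.
have tail (n i : nat) : vge v n%:Z (u (n + i)%N - u n).
  elim: i => [|i IH]; first by rewrite addn0 subrr; apply: vge0.
  have -> : u (n + i.+1)%N - u n =
    (u (n + i).+1 - u (n + i)%N) + (u (n + i)%N - u n) by rewrite addnS; ring.
  by apply: (vgeD HF) => //; apply: vge_le (step _); lia.
have cauchy (n : int) : exists N, forall i j, (N <= i)%N -> (N <= j)%N ->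
    vge v n (u i - u j).
  exists `|n|%N => i j /subnKC <- /subnKC <-.
  set N := `|n|%N.
  have -> p q : u (N + p)%N - u (N + q)%N = (u (N + p)%N - u N) -
    (u (N + q)%N - u N) by ring.
  by apply: (vgeB HF); apply: vge_le (tail _ _); lia.
have [_ _ _ /(_ u cauchy)[l hl] _] := HF.
have l0 : vge v 0 l.
  have [N /(_ N (leqnn N)) h] := hl 0.
  have -> : l = u N - (u N - l) by ring.
  exact: (vgeB HF).
exists l; apply/eqP; rewrite -subr_eq0; apply/eqP/vge_all_eq0 => n.
have [N h] := hl n.
have -> : l - (1 + m * l ^+ 2) =
    - (u N.+1 - l) + m * (u N + l) * (u N - l) by rewrite uS; ring.
apply: (vgeD HF); first by apply: (vgeN HF); apply: h.
by apply: (vgeMl HF); [vint HF|apply: h].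
Qed.

(** Hensel's lemma in a form suited to 2 not being a unit: t = -(c/b) s turns the equation into s =
    1 + (ac/b^2) s^2, where ac/b^2 lies in p. *)
Lemma quadratic_root (a b c : F) : b != 0 -> vge v (2 * v b + 1) (a * c) ->
  exists t, a * t ^+ 2 + b * t + c = 0.
Proof.
move=> b0 h.
have hm : vge v 1 ((b ^+ 2)^-1 * (a * c)).
  have := vge_Vl HF (expf_neq0 2 b0) h; rewrite (vX2 HF) //.
  by apply: vge_le; lia.
have [s hs] := quadratic_fixpoint hm.
exists (- (c / b) * s).
have -> : a * (- (c / b) * s) ^+ 2 + b * (- (c / b) * s) + c =
  c * (1 + (b ^+ 2)^-1 * (a * c) * s ^+ 2 - s) by field.
by rewrite -hs subrr mulr0.
Qed.

End Hensel.

Section CauchySchwarz.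
Variables (F : fieldType) (v : F -> int).
Hypothesis HF : local_field v.
Variables (U : lmodType F) (f : U -> U -> F).
Hypothesis fC : forall x y, f x y = f y x.
Hypothesis fP : forall a x y z, f (a *: x + y) z = a * f x z + f y z.
Hypothesis aniso : forall x, f x x = 0 -> x = 0.

Lemma bilPr a x y z : f z (a *: x + y) = a * f z x + f z y.
Proof. by rewrite fC fP !(fC z). Qed.

Lemma bil0l z : f 0 z = 0.
Proof. by have := fP (-1) 0 0 z; rewrite scaler0 addr0 mulN1r addNr. Qed.

Lemma bilZl a x y : f (a *: x) y = a * f x y.
Proof. by have := fP a x 0 y; rewrite addr0 bil0l addr0. Qed.

Lemma bilZr a x y : f x (a *: y) = a * f x y.
Proof. by rewrite fC bilZl fC. Qed.

Lemma bilDl x y z : f (x + y) z = f x z + f y z.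
Proof. by have := fP 1 x y z; rewrite scale1r mul1r. Qed.

Lemma bilDr x y z : f z (x + y) = f z x + f z y.
Proof. by rewrite fC bilDl !(fC z). Qed.

(* If the bound failed, f (t x + y) (t x + y) would have a root t by Hensel. *)
Lemma cauchy_schwarz n m j x y : vge v n (f x x) -> vge v m (f y y) ->
  2 * j <= n + m + 1 -> vge v j (2%:R * f x y).
Proof.
move=> hx hy hj g0; rewrite leNgt; apply/negP => lt.
have hxy : vge v (2 * v (2%:R * f x y) + 1) (f x x * f y y).
  by apply: vge_le (vgeM HF hx hy); lia.
have [t ht] := quadratic_root HF g0 hxy.
have : f (t *: x + y) (t *: x + y) = 0.
  by rewrite fP !bilPr (fC y x) -ht; ring.
(* By anisotropy [x] and [y] are proportional. Then the square of 2 f(x, y) is 4 f(x, x) f(y, y),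
   whose valuation is at least that of f(x, x) f(y, y), against [hxy]. *)
move/aniso/eqP; rewrite addr_eq0 => /eqP tx.
have yE : y = - t *: x by rewrite scaleNr tx opprK.
have t0 : t != 0.
  by apply: contraNneq g0 => e; rewrite yE bilZr e oppr0 mul0r mulr0.
have fx0 : f x x != 0.
  by apply: contraNneq g0 => e; rewrite yE bilZr e !mulr0.
have n2 : 2%:R != 0 :> F.
  by apply: contraNneq g0 => e; rewrite e mul0r.
have fy : f y y = t ^+ 2 * f x x by rewrite yE bilZl bilZr; ring.
have g2 : (2%:R * f x y) ^+ 2 = 4%:R * (f x x * f y y).
  by rewrite fy yE bilZr; ring.
have n4 : 4%:R != 0 :> F by rewrite (natrM F 2 2) mulf_neq0.
have fy0 : f y y != 0 by rewrite fy mulf_neq0 // expf_neq0.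
have := hxy (mulf_neq0 fx0 fy0).
have := vX2 HF g0; rewrite g2 (vM HF) ?mulf_neq0 //.
have := vge_nat HF 4 n4; lia.
Qed.

End CauchySchwarz.

(** * Maximal ternary lattices *)

Section Span.
Variables (F : fieldType) (g : set F).

Lemma gspan_submodule (U : lmodType F) (X : set U) : gsubmodule g (gspan g X).
Proof.
split=> [Y [[]] //|x y hx hy Y hY|a x ha hx Y hY].
  by have [[_ YD _] _] := hY; apply: YD; [apply: hx|apply: hy].
by have [[_ _ YZ] _] := hY; apply: YZ => //; apply: hx.
Qed.

Lemma gspan_incl (U : lmodType F) (X : set U) : X `<=` gspan g X.
Proof. by move=> x Xx Y [_]; apply. Qed.

Lemma gspan_min (U : lmodType F) (X Y : set U) :
  gsubmodule g Y -> X `<=` Y -> gspan g X `<=` Y.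
Proof. by move=> hY XY x; apply. Qed.

End Span.

Section Maximal.
Variables (F : fieldType) (v : F -> int).
Hypothesis HF : local_field v.
Variables (U : vectType F) (f : U -> U -> F).
Hypothesis fC : forall x y, f x y = f y x.
Hypothesis fP : forall a x y z, f (a *: x + y) z = a * f x z + f y z.

Lemma integral_submodule (L : set U) : integral_lattice (integers v) f L ->
  gsubmodule (integers v) L.
Proof. by case=> [[[s ->] _] _]; apply: gspan_submodule. Qed.

(** The form in which maximality is used: Q is integral on M + g w, so this lattice cannot exceed
    M. *)
Lemma maximal_lattice_mem (M : set U) (w : U) :
  maximal_lattice (integers v) f M -> vge v 0 (f w w) ->
  (forall x, M x -> vge v 0 (2%:R * f x w)) -> M w.
Proof.
move=> [intM maxM] hw hMw; have [M0 MD MZ] := integral_submodule intM.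
have [[[s Ms] [X bX XM]] QM] := intM.
pose M' := gspan (integers v) [set x | x \in rcons s w].
have M'w : M' w by apply: gspan_incl; rewrite /= mem_rcons mem_head.
have MM' : M `<=` M'.
  rewrite Ms; apply: gspan_min; first exact: gspan_submodule.
  by move=> x /= xs; apply: gspan_incl; rewrite /= mem_rcons inE xs orbT.
suff <- : M' = M by [].
apply: maxM => //; split; first by split; [exists (rcons s w)|exists X; auto].
pose S := [set x + t *: w | x in M & t in integers v].
have M'S : M' `<=` S.
  apply: gspan_min => [|x /=].
    split=> [|_ _ [x Mx [t ht <-]] [y My [u hu <-]]|a _ ha [x Mx [t ht <-]]].
    - by exists 0 => //; exists 0; [apply: vge0|rewrite scale0r addr0].
    - exists (x + y); first exact: MD.
      by exists (t + u); [apply: (vgeD HF)|rewrite scalerDl addrACA].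
    - exists (a *: x); first exact: MZ.
      by exists (a * t); [apply: (vgeMl HF)|rewrite scalerDr scalerA].
  rewrite mem_rcons inE => /orP[/eqP ->|xs].
    exists 0 => //; exists 1; first exact: (vge_1 HF).
    by rewrite scale1r add0r.
  exists x; first by rewrite Ms; apply: gspan_incl.
  by exists 0; [apply: vge0|rewrite scale0r addr0].
move=> _ /M'S[x Mx [t ht <-]].
have -> : f (x + t *: w) (x + t *: w) =
    f x x + t * (2%:R * f x w) + t ^+ 2 * f w w.
  rewrite (bilDl fP) !(bilDr fC fP) !(bilZl fP) !(bilZr fC fP) (fC w x).
  by ring.
by have := hMw x Mx; have := QM x Mx; rewrite /integers /= => ? ?; vint HF.
Qed.

End Maximal.

(** * Ternary forms in an orthogonal frame, and bases of their lattices *)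

Section TernarySpace.
Variables (F : fieldType) (U : vectType F) (f : U -> U -> F).
Variables (k1 k2 k3 : U) (X Y Z : {scalar U}).
Hypothesis coordE : forall w, w = X w *: k1 + Y w *: k2 + Z w *: k3.
Hypothesis coordk1 : [/\ X k1 = 1, Y k1 = 0 & Z k1 = 0].
Hypothesis coordk2 : [/\ X k2 = 0, Y k2 = 1 & Z k2 = 0].
Hypothesis coordk3 : [/\ X k3 = 0, Y k3 = 0 & Z k3 = 1].
Variables (a1 a2 a3 : F).
Hypothesis fE : forall x y,
  f x y = a1 * X x * X y + a2 * Y x * Y y + a3 * Z x * Z y.

Let fC x y : f x y = f y x. Proof. by rewrite !fE; ring. Qed.

Let fP a x y z : f (a *: x + y) z = a * f x z + f y z.
Proof. by rewrite !fE !linearP /=; ring. Qed.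

Definition detk (x y z : U) : F :=
  X x * (Y y * Z z - Z y * Y z) - Y x * (X y * Z z - Z y * X z)
  + Z x * (X y * Y z - Y y * X z).

(** Half the determinant of the Gram matrix of 2 f. In odd dimension the halving still leaves
    integer coefficients in terms of Q and 2 f. *)
Definition half_det (x y z : U) : F :=
  let a := f x x in let d := f y y in let c := f z z in
  let yz := 2%:R * f y z in let xz := 2%:R * f x z in let xy := 2%:R * f x y in
  4%:R * a * d * c + xy * xz * yz - a * yz ^+ 2 - d * xz ^+ 2 - c * xy ^+ 2.

Lemma half_detE x y z :
  half_det x y z = 4%:R * (a1 * a2 * a3) * detk x y z ^+ 2.
Proof. by rewrite /half_det /detk !fE /=; ring. Qed.

Lemma coord_inj x y : X x = X y -> Y x = Y y -> Z x = Z y -> x = y.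
Proof. by move=> eX eY eZ; rewrite [x]coordE [y]coordE eX eY eZ. Qed.

Lemma cramer e1 e2 e3 w : detk e1 e2 e3 *: w =
  detk w e2 e3 *: e1 + detk e1 w e3 *: e2 + detk e1 e2 w *: e3.
Proof. by apply: coord_inj; rewrite !linearE /= /detk; ring. Qed.

Lemma detk_comb e1 e2 e3 x1 x2 x3 y1 y2 y3 z1 z2 z3 :
  detk (x1 *: e1 + x2 *: e2 + x3 *: e3) (y1 *: e1 + y2 *: e2 + y3 *: e3)
       (z1 *: e1 + z2 *: e2 + z3 *: e3) =
  (x1 * (y2 * z3 - y3 * z2) - x2 * (y1 * z3 - y3 * z1)
   + x3 * (y1 * z2 - y2 * z1)) * detk e1 e2 e3.
Proof. by rewrite /detk !linearE /=; ring. Qed.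


Variable v : F -> int.
Hypothesis HF : local_field v.
Hypothesis two_neq0 : 2%:R != 0 :> F.
Hypothesis disc_neq0 : a1 * a2 * a3 != 0.

Definition lattice_basis (L : set U) e1 e2 e3 : Prop :=
  [/\ L e1, L e2, L e3, detk e1 e2 e3 != 0 & forall w, L w ->
    exists x y z, [/\ vge v 0 x, vge v 0 y, vge v 0 z &
      w = x *: e1 + y *: e2 + z *: e3]].

Lemma four_neq0 : 4%:R != 0 :> F.
Proof. by rewrite (natrM F 2 2) mulf_neq0. Qed.

Lemma half_det_neq0 x y z : detk x y z != 0 -> half_det x y z != 0.
Proof. move=> d0; rewrite half_detE mulf_neq0 ?expf_neq0 //.
exact: mulf_neq0 four_neq0 disc_neq0. Qed.

Lemma v_half_det x y z : detk x y z != 0 ->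
  v (half_det x y z) = 2 * v 2%:R + v (a1 * a2 * a3) + 2 * v (detk x y z).
Proof.
move=> d0; rewrite half_detE (vM HF) ?expf_neq0 //.
  rewrite (vX2 HF) // (vM HF four_neq0 disc_neq0) (natrM F 2 2) (vM HF) //.
  by lia.
exact: mulf_neq0 four_neq0 disc_neq0.
Qed.

Section Submodule.
Variable L : set U.
Hypothesis subL : gsubmodule (integers v) L.

Lemma submod_comb e1 e2 e3 x y z : L e1 -> L e2 -> L e3 ->
  vge v 0 x -> vge v 0 y -> vge v 0 z -> L (x *: e1 + y *: e2 + z *: e3).
Proof.
by have [_ LD LZ] := subL; move=> *; apply: (LD); [apply: (LD)|]; apply: LZ.
Qed.

Lemma lattice_basis_min e1 e2 e3 : L e1 -> L e2 -> L e3 ->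
  detk e1 e2 e3 != 0 ->
  (forall x y z, L x -> L y -> L z ->
     vge v (v (detk e1 e2 e3)) (detk x y z)) ->
  lattice_basis L e1 e2 e3.
Proof.
move=> L1 L2 L3 d0 dmin; split=> // w Lw; set d := detk e1 e2 e3 in d0 dmin *.
exists (d^-1 * detk w e2 e3), (d^-1 * detk e1 w e3), (d^-1 * detk e1 e2 w).
have int_ratio x y z : L x -> L y -> L z -> vge v 0 (d^-1 * detk x y z).
  by move=> *; rewrite -[0](subrr (v d)); apply: (vge_Vl HF) => //; apply: dmin.
split; try exact: int_ratio.
apply: (scalerI d0); rewrite cramer !scalerDr !scalerA !mulrA mulfV //.
by rewrite !mul1r.
Qed.

Lemma detk_lattice_ge e1 e2 e3 x y z : lattice_basis L e1 e2 e3 ->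
  L x -> L y -> L z -> vge v (v (detk e1 e2 e3)) (detk x y z).
Proof.
case=> _ _ _ _ gen /gen[x1 [x2 [x3 [? ? ? ->]]]] /gen[y1 [y2 [y3 [? ? ? ->]]]].
move=> /gen[z1 [z2 [z3 [? ? ? ->]]]]; rewrite detk_comb.
by apply: (vgeMl HF); [vint HF|apply: vge_v].
Qed.

(** A unit factor keeps the valuation of [detk] minimal on L, and minimality makes a basis. *)
Lemma lattice_basis_change e1 e2 e3 f1 f2 f3 u : lattice_basis L e1 e2 e3 ->
  L f1 -> L f2 -> L f3 -> u != 0 -> v u = 0 ->
  detk f1 f2 f3 = u * detk e1 e2 e3 -> lattice_basis L f1 f2 f3.
Proof.
move=> be L1 L2 L3 u0 vu df; have [_ _ _ d0 _] := be.
apply: lattice_basis_min => //; first by rewrite df mulf_neq0.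
by move=> x y z *; rewrite df (vM HF) // vu add0r; apply: detk_lattice_ge.
Qed.

Lemma v_detk_lattice_basis e1 e2 e3 f1 f2 f3 :
  lattice_basis L e1 e2 e3 -> lattice_basis L f1 f2 f3 ->
  v (detk e1 e2 e3) = v (detk f1 f2 f3).
Proof.
move=> be bf; have [e1L e2L e3L e0 _] := be; have [f1L f2L f3L f0 _] := bf.
have := detk_lattice_ge be f1L f2L f3L f0.
by have := detk_lattice_ge bf e1L e2L e3L e0; lia.
Qed.

Lemma half_det_int x y z : (forall w, L w -> vge v 0 (f w w)) ->
  L x -> L y -> L z -> vge v 0 (half_det x y z).
Proof.
have [_ LD _] := subL.
move=> QL Lx Ly Lz; have int2 x' y' : L x' -> L y' -> vge v 0 (2%:R * f x' y').
  move=> Lx' Ly'.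
  have -> : 2%:R * f x' y' = f (x' + y') (x' + y') - f x' x' - f y' y'.
    by rewrite (bilDl fP) !(bilDr fC fP) (fC y' x'); ring.
  have := QL _ (LD _ _ Lx' Ly'); have := QL _ Lx'; have := QL _ Ly' => *.
  by vint HF.
have := QL _ Lx; have := QL _ Ly; have := QL _ Lz.
have := int2 _ _ Lx Ly; have := int2 _ _ Lx Lz; have := int2 _ _ Ly Lz => *.
by rewrite /half_det; vint HF.
Qed.

(* A triple of vectors of L with v (detk) minimal is a basis: by Cramer's rule
   the coordinates of vectors of L are ratios of such determinants. *)
Lemma exists_lattice_basis x y z : (forall w, L w -> vge v 0 (f w w)) ->
  L x -> L y -> L z -> detk x y z != 0 ->
  exists e1 e2 e3, lattice_basis L e1 e2 e3.
Proof.
(* [half_det] is integral on L, so v([detk]) is bounded below; the shift by [N] turns these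
   valuations into natural numbers, among which a least one exists. *)
move=> QL Lx Ly Lz d0; pose N := `|(2 * v 2%:R + v (a1 * a2 * a3))%R|%N.
have lb x' y' z' : L x' -> L y' -> L z' -> detk x' y' z' != 0 ->
    0 <= v (detk x' y' z') + N%:Z.
  move=> Lx' Ly' Lz' d0'.
  have := half_det_int QL Lx' Ly' Lz' (half_det_neq0 d0').
  by rewrite v_half_det //; lia.
pose P n := `[< exists x y z, [/\ L x, L y, L z, detk x y z != 0 &
  v (detk x y z) + N%:Z = n%:Z] >].
have exP : exists n, P n.
  exists `|(v (detk x y z) + N%:Z)%R|%N.
  apply/asboolP; exists x, y, z; split=> //.
  by have := lb x y z Lx Ly Lz d0; lia.
have [n /asboolP[e1 [e2 [e3 [L1 L2 L3 e0 en]]]] nmin] := ex_minnP exP.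
exists e1, e2, e3; apply: lattice_basis_min => // x' y' z' Lx' Ly' Lz' d0'.
have := lb x' y' z' Lx' Ly' Lz' d0' => ge0.
suff /nmin : P `|(v (detk x' y' z') + N%:Z)%R|%N by lia.
by apply/asboolP; exists x', y', z'; split=> //; lia.
Qed.

End Submodule.

(** The primitive vector takes the place of a basis vector on which it has a unit coordinate, so
    [detk] changes by a unit only. *)
Lemma lattice_basis_ext3 (L : set U) e1 e2 e3 x y z :
  gsubmodule (integers v) L -> lattice_basis L e1 e2 e3 ->
  vge v 0 x -> vge v 0 y -> vge v 0 z ->
  ~ [/\ vge v 1 x, vge v 1 y & vge v 1 z] ->
  exists f1 f2, lattice_basis L f1 f2 (x *: e1 + y *: e2 + z *: e3).
Proof.
move=> subL be hx hy hz prim; have [L1 L2 L3 d0 _] := be.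
have Lw := submod_comb subL L1 L2 L3 hx hy hz.
have change f1 f2 u := @lattice_basis_change L _ _ _ f1 f2
  (x *: e1 + y *: e2 + z *: e3) u be.
have [pz|nz] := EM (vge v 1 z); last first.
  have [z0 vz] := v_unit_of_not_p hz nz.
  exists e1, e2; apply: (change _ _ z) => //.
  by rewrite /detk !linearE /=; ring.
have [py|ny] := EM (vge v 1 y); last first.
  have [y0 vy] := v_unit_of_not_p hy ny.
  exists e1, e3; apply: (change _ _ (- y)); rewrite ?oppr_eq0 ?(vN HF) //.
  by rewrite /detk !linearE /=; ring.
have [x0 vx] := @v_unit_of_not_p _ _ x hx (fun px => prim (And3 px py pz)).
exists e2, e3; apply: (change _ _ x) => //.
by rewrite /detk !linearE /=; ring.
Qed.

Lemma lattice_basis_ext2 (L : set U) e1 e2 e3 x y :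
  gsubmodule (integers v) L -> lattice_basis L e1 e2 e3 ->
  vge v 0 x -> vge v 0 y -> ~ (vge v 1 x /\ vge v 1 y) ->
  exists f1, lattice_basis L f1 (x *: e1 + y *: e2) e3.
Proof.
move=> subL be hx hy prim; have [L1 L2 L3 d0 _] := be.
have Lw : L (x *: e1 + y *: e2).
  have := submod_comb subL L1 L2 L3 hx hy (vge0 v 0).
  by rewrite scale0r addr0.
have change f1 u := @lattice_basis_change L _ _ _ f1
  (x *: e1 + y *: e2) e3 u be.
have [py|ny] := EM (vge v 1 y); last first.
  have [y0 vy] := v_unit_of_not_p hy ny.
  exists e1; apply: (change _ y) => //.
  by rewrite /detk !linearE /=; ring.
have [x0 vx] := @v_unit_of_not_p _ _ x hx (fun px => prim (conj px py)).
exists e2; apply: (change _ (- x)); rewrite ?oppr_eq0 ?(vN HF) //.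
by rewrite /detk !linearE /=; ring.
Qed.

Variable pi : F.
Hypothesis Hpi : prime_element v pi.

Lemma lattice_basis_div_pi (L : set U) e1 e2 e3 x y z :
  lattice_basis L e1 e2 e3 -> L (pi^-1 *: (x *: e1 + y *: e2 + z *: e3)) ->
  [/\ vge v 1 x, vge v 1 y & vge v 1 z].
Proof.
case=> _ _ _ d0 gen /gen[a [b [c [ha hb hc]]]].
move/(congr1 ( *:%R pi)); rewrite scalerA mulfV ?(pi_neq0 Hpi) // scale1r => e.
have h (t s : F) : vge v 0 t -> s * detk e1 e2 e3 = pi * t * detk e1 e2 e3 ->
    vge v 1 s.
  by move=> ht /(mulIf d0) ->; rewrite -[1]add0r; apply: (vge_mul_pi HF Hpi).
split; [apply: (h a)|apply: (h b)|apply: (h c)] => //.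
- have : detk (x *: e1 + y *: e2 + z *: e3) e2 e3 = x * detk e1 e2 e3.
    by rewrite /detk !linearE /=; ring.
  by rewrite e => <-; rewrite /detk !linearE /=; ring.
- have : detk e1 (x *: e1 + y *: e2 + z *: e3) e3 = y * detk e1 e2 e3.
    by rewrite /detk !linearE /=; ring.
  by rewrite e => <-; rewrite /detk !linearE /=; ring.
- have : detk e1 e2 (x *: e1 + y *: e2 + z *: e3) = z * detk e1 e2 e3.
    by rewrite /detk !linearE /=; ring.
  by rewrite e => <-; rewrite /detk !linearE /=; ring.
Qed.

(** * Half-discriminants of maximal ternary lattices *)

Section MaximalTernary.
Variable M : set U.
Hypothesis maxM : maximal_lattice (integers v) f M.

Let subM : gsubmodule (integers v) M.
Proof. by case: maxM => /integral_submodule. Qed.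

Let QM w : M w -> vge v 0 (f w w).
Proof. by case: maxM => -[_ h] _ /h. Qed.

Lemma form_comb e1 e2 e3 x y z :
  f (x *: e1 + y *: e2 + z *: e3) (x *: e1 + y *: e2 + z *: e3) =
  f e1 e1 * x ^+ 2 + f e2 e2 * y ^+ 2 + f e3 e3 * z ^+ 2
  + 2%:R * f e1 e2 * x * y + 2%:R * f e1 e3 * x * z + 2%:R * f e2 e3 * y * z.
Proof. by rewrite !fE !linearE /=; ring. Qed.

Section Anisotropic.
Hypothesis aniso : forall x, f x x = 0 -> x = 0.

Let CS := cauchy_schwarz HF fC fP aniso.

(** If Q[w] is in p^2, then Q[w / pi] is integral and Cauchy-Schwarz makes 2 f(x, w / pi) integral
    for all x in M, so maximality puts w / pi in M. *)
Lemma anisotropic_primitive e1 e2 e3 x y z : lattice_basis M e1 e2 e3 ->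
  vge v 0 x -> vge v 0 y -> vge v 0 z ->
  vge v 2 (f (x *: e1 + y *: e2 + z *: e3) (x *: e1 + y *: e2 + z *: e3)) ->
  [/\ vge v 1 x, vge v 1 y & vge v 1 z].
Proof.
move=> be hx hy hz h; apply: (lattice_basis_div_pi be).
have hq : vge v 0 (f (pi^-1 *: (x *: e1 + y *: e2 + z *: e3))
                    (pi^-1 *: (x *: e1 + y *: e2 + z *: e3))).
  rewrite (bilZl fP) (bilZr fC fP).
  by do 2!apply: (vge_div_pi HF Hpi).
apply: (maximal_lattice_mem HF fC fP maxM hq) => w Mw.
by apply: CS (QM Mw) hq _.
Qed.

Lemma anisotropic_half_det : (exists e1 e2 e3, lattice_basis M e1 e2 e3) ->
  exists e1 e2 e3, lattice_basis M e1 e2 e3 /\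
    (v (half_det e1 e2 e3) = 1 \/ v (half_det e1 e2 e3) = 2).
Proof.
move=> [g1 [g2 [g3 bg]]]; have [M1 M2 M3 _ _] := bg.
have B0 x y : M x -> M y -> vge v 0 (2%:R * f x y).
  by move=> Mx My; apply: CS (QM Mx) (QM My) _.
have [x [y [z [hx hy hz prim hQ]]]] :=
  ternary_isotropic_mod_p HF (QM M1) (B0 _ _ M1 M2) (B0 _ _ M1 M3) (QM M2)
    (B0 _ _ M2 M3) (QM M3).
rewrite -form_comb in hQ.
have [e1 [e2 be]] := lattice_basis_ext3 subM bg hx hy hz prim.
move: be hQ; move: (x *: g1 + y *: g2 + z *: g3) => e3 be f3.
clear x y z hx hy hz prim.
have {M1 M2 M3}[M1 M2 M3 _ _] := be.
(* The inequality bounds this valuation below by 1/2, and it is an integer. *)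
have B1 w e : M w -> vge v 1 (f e e) -> vge v 1 (2%:R * f w e).
  by move=> Mw he; apply: CS (QM Mw) he _.
have npi1 : ~ vge v 1 1 by apply: (unit_not_p (oner_neq0 F) (v1 HF)).
have np2 g1' g2' g3' : lattice_basis M g1' g2' g3' -> ~ vge v 2 (f g3' g3').
  move=> bg' h; have [] := @anisotropic_primitive _ _ _ 0 0 1 bg'; vint HF.
    by rewrite !scale0r !add0r scale1r.
  by move=> _ _; apply: npi1.
(* [e3] belongs to a basis, so Q[e3] is not in p^2 and its valuation is exactly 1. *)
have [f30 vf3] := v_eq f3 (np2 _ _ _ be).
have b12 := B0 _ _ M1 M2.
have [aniso12|iso12] := EM (forall x y, vge v 0 x -> vge v 0 y ->
    vge v 1 (f e1 e1 * x ^+ 2 + 2%:R * f e1 e2 * x * y + f e2 e2 * y ^+ 2) ->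
    vge v 1 x /\ vge v 1 y).
  have nD := binary_disc_unit HF (QM M1) b12 (QM M2) aniso12.
  have b13 := B1 _ _ M1 f3; have b23 := B1 _ _ M2 f3.
  have hD0 : vge v 0 (4%:R * f e1 e1 * f e2 e2 - (2%:R * f e1 e2) ^+ 2).
    by have := QM M1; have := QM M2 => *; vint HF.
  have [D0 vD] := v_unit_of_not_p hD0 nD.
  exists e1, e2, e3; split=> //; left.
  set D := _ - _ in D0 vD; have m0 : f e3 e3 * D != 0 by rewrite mulf_neq0.
  have vm : v (f e3 e3 * D) = 1 by rewrite (vM HF) // vf3 vD.
  rewrite -vm; apply: (vB_eq HF m0 _).2; rewrite vm.
  (* Modulo p^2 the half-discriminant is that of the orthogonal sum of e1, e2 and e3, because 2
     f(e1, e3) and 2 f(e2, e3) lie in p. *)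
  have -> : f e3 e3 * D - half_det e1 e2 e3 = f e1 e1 * (2%:R * f e2 e3) ^+ 2 +
      f e2 e2 * (2%:R * f e1 e3) ^+ 2 -
      2%:R * f e1 e2 * ((2%:R * f e1 e3) * (2%:R * f e2 e3)).
    by rewrite /half_det /D; ring.
  have s23 := vgeX2 HF b23; have s13 := vgeX2 HF b13.
  have h1 := vgeMl HF (QM M1) s23; have h2 := vgeMl HF (QM M2) s13.
  have h3 := vgeMl HF b12 (vgeM HF b13 b23).
  by apply: (vgeB HF) => //; apply: (vgeD HF).
have [x' [y' [hx' hy' hQ' prim']]] : exists x y, [/\ vge v 0 x, vge v 0 y,
    vge v 1 (f e1 e1 * x ^+ 2 + 2%:R * f e1 e2 * x * y + f e2 e2 * y ^+ 2) &
    ~ (vge v 1 x /\ vge v 1 y)].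
  apply: contrapT => none; apply: iso12 => x' y' hx' hy' hQ'.
  by apply: contrapT => prim'; apply: none; exists x', y'.
have [f1 be'] := lattice_basis_ext2 subM be hx' hy' prim'.
have f2 : vge v 1 (f (x' *: e1 + y' *: e2) (x' *: e1 + y' *: e2)).
  have := form_comb e1 e2 e3 x' y' 0.
  rewrite scale0r addr0 => ->; move: hQ'; congr (vge v 1 _); ring.
move: be' f2; move: (x' *: e1 + y' *: e2) => h2 be' f2.
have {M1 M2 M3 b12}[M1 M2 M3 _ _] := be'.
set a := f f1 f1; set d := f h2 h2 in f2; set c := f e3 e3 in f3 f30 vf3.
pose b12 := 2%:R * f f1 h2; pose b13 := 2%:R * f f1 e3.
pose b23 := 2%:R * f h2 e3.
have p12 : vge v 1 b12 by apply: B1.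
have p13 : vge v 1 b13 by apply: B1.
have p23 : vge v 1 b23 by apply: B1.
have qE x y z : f (x *: f1 + y *: h2 + z *: e3) (x *: f1 + y *: h2 + z *: e3)
    = a * x ^+ 2 + d * y ^+ 2 + c * z ^+ 2
    + b12 * x * y + b13 * x * z + b23 * y * z.
  by rewrite form_comb.
have divp s : vge v 1 s -> vge v 0 (pi^-1 * s).
  by move=> hs; apply: (vge_div_pi HF Hpi).
have mulp s : vge v 1 (pi^-1 * s) -> vge v 2 s.
  move=> /(vge_mul_pi HF Hpi); rewrite mulrA mulfV ?(pi_neq0 Hpi) //.
  by rewrite mul1r.
(* Otherwise Q / pi would be an integral ternary form on M, and a primitive zero of it modulo p
   would be a primitive w with Q[w] in p^2. *)
have npa : ~ vge v 1 a.
  move=> pa.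
  have [x [y [z [hx0 hy0 hz0 prim0 hq]]]] := ternary_isotropic_mod_p HF
    (divp _ pa) (divp _ p12) (divp _ p13) (divp _ f2) (divp _ p23) (divp _ f3).
  apply: prim0; apply: (anisotropic_primitive be') => //.
  apply: mulp; rewrite qE; move: hq; congr (vge v 1 _); ring.
have [a0 va] := v_unit_of_not_p (QM M1) npa.
have aniso23 x y : vge v 0 x -> vge v 0 y -> vge v 1 (pi^-1 * d * x ^+ 2 +
    pi^-1 * b23 * x * y + pi^-1 * c * y ^+ 2) -> vge v 1 x /\ vge v 1 y.
  move=> hx0 hy0 hq.
  have hq2 : vge v 2 (f (0 *: f1 + x *: h2 + y *: e3)
                        (0 *: f1 + x *: h2 + y *: e3)).
    by apply: mulp; rewrite qE; move: hq; congr (vge v 1 _); ring.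
  by have [_] := anisotropic_primitive be' (vge0 v 0) hx0 hy0 hq2.
have nD := binary_disc_unit HF (divp _ f2) (divp _ p23) (divp _ f3) aniso23.
have hD0 : vge v 0 (4%:R * (pi^-1 * d) * (pi^-1 * c) - (pi^-1 * b23) ^+ 2).
  by have := divp _ f2; have := divp _ f3; have := divp _ p23 => *; vint HF.
have [D0 vD] := v_unit_of_not_p hD0 nD.
exists f1, h2, e3; split=> //; right.
set D := _ - _ in D0 vD; have pi0 := pi_neq0 Hpi.
have m0 : a * pi ^+ 2 * D != 0 by rewrite !mulf_neq0 // expf_neq0.
have vm : v (a * pi ^+ 2 * D) = 2.
  rewrite (vM HF (mulf_neq0 a0 (expf_neq0 2 pi0)) D0).
  by rewrite (vM HF a0 (expf_neq0 2 pi0)) (v_piX HF Hpi) va vD.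
rewrite -vm; apply: (vB_eq HF m0 _).2; rewrite vm.
(* Modulo p^3 only a (4 d c - b23^2), which is a pi^2 D, survives. *)
have -> : a * pi ^+ 2 * D - half_det f1 h2 e3 =
    d * b13 ^+ 2 + c * b12 ^+ 2 - b12 * (b13 * b23).
  by rewrite /half_det /D -/a -/d -/c -/b12 -/b13 -/b23; field.
have s13 := vgeM HF f2 (vgeX2 HF p13); have s12 := vgeM HF f3 (vgeX2 HF p12).
have s := vgeM HF p12 (vgeM HF p13 p23).
by apply: (vgeB HF) => //; apply: (vgeD HF).
Qed.

End Anisotropic.

(** The multiplier is the inverse of a nonzero coordinate of least valuation. *)
Lemma primitive_multiple (x y z : F) : ~ [/\ x = 0, y = 0 & z = 0] ->
  exists t, [/\ t != 0, vge v 0 (t * x), vge v 0 (t * y), vge v 0 (t * z) &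
    ~ [/\ vge v 1 (t * x), vge v 1 (t * y) & vge v 1 (t * z)]].
Proof.
move=> nz.
have scale a b c : a != 0 -> vge v (v a) b -> vge v (v a) c ->
    [/\ vge v 0 (a^-1 * a), vge v 0 (a^-1 * b), vge v 0 (a^-1 * c) &
        ~ vge v 1 (a^-1 * a)].
  move=> a0 hb hc; rewrite mulVf //; split; first exact: (vge_1 HF).
  - by have := vge_Vl HF a0 hb; rewrite subrr.
  - by have := vge_Vl HF a0 hc; rewrite subrr.
  - exact: (unit_not_p (oner_neq0 F) (v1 HF)).
have [x_min|x_min] := EM [/\ x != 0, vge v (v x) y & vge v (v x) z].
  have [x0 hy hz] := x_min; have [h1 h2 h3 h4] := scale _ _ _ x0 hy hz.
  by exists x^-1; split=> //; [rewrite invr_neq0|case].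
have [y_min|y_min] := EM [/\ y != 0, vge v (v y) x & vge v (v y) z].
  have [y0 hx hz] := y_min; have [h1 h2 h3 h4] := scale _ _ _ y0 hx hz.
  by exists y^-1; split=> //; [rewrite invr_neq0|case].
have [z_min|z_min] := EM [/\ z != 0, vge v (v z) x & vge v (v z) y].
  have [z0 hx hy] := z_min; have [h1 h2 h3 h4] := scale _ _ _ z0 hx hy.
  by exists z^-1; split=> //; [rewrite invr_neq0|case].
exfalso; move: x_min y_min z_min nz; rewrite /vge.
have [->|x0] := eqVneq x 0; have [->|y0] := eqVneq y 0;
  have [->|z0] := eqVneq z 0; rewrite ?eqxx => hx hy hz nz.
- by apply: nz.
- by apply: hz.
- by apply: hy.
- have [le|le] := lerP (v y) (v z); first by apply: hy.
  by apply: hz; split=> // _; exact: ltW.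
- by apply: hx.
- have [le|le] := lerP (v x) (v z); first by apply: hx.
  by apply: hz; split=> // _; exact: ltW.
- have [le|le] := lerP (v x) (v y); first by apply: hx.
  by apply: hy; split=> // _; exact: ltW.
- have [le|le] := lerP (v x) (v y); have [le'|le'] := lerP (v x) (v z);
    have [le''|le''] := lerP (v y) (v z).
  all: try by apply: hx; split=> // _; lia.
  all: try by apply: hy; split=> // _; lia.
  all: by apply: hz; split=> // _; lia.
Qed.

Lemma isotropic_half_det w : w != 0 -> f w w = 0 ->
  (exists e1 e2 e3, lattice_basis M e1 e2 e3) ->
  exists e1 e2 e3, lattice_basis M e1 e2 e3 /\
    (v (half_det e1 e2 e3) = 0 \/ v (half_det e1 e2 e3) = 1).
Proof.
move=> w0 fw [g1 [g2 [g3 bg]]]; have [M1 M2 M3 d0 _] := bg.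
have B0 x y : M x -> M y -> vge v 0 (2%:R * f x y).
  have [_ MD _] := subM; move=> Mx My.
  have -> : 2%:R * f x y = f (x + y) (x + y) - f x x - f y y.
    by rewrite !fE !linearE /=; ring.
  have := QM (MD _ _ Mx My); have := QM Mx; have := QM My => *.
  by vint HF.
pose d := detk g1 g2 g3; pose x := detk w g2 g3; pose y := detk g1 w g3.
pose z := detk g1 g2 w.
have wE : d *: w = x *: g1 + y *: g2 + z *: g3 by apply: cramer.
have [|t [t0 hx hy hz prim]] := @primitive_multiple x y z.
  case=> x0 y0 z0; move/eqP: wE; rewrite x0 y0 z0 !scale0r !addr0 scaler_eq0.
  by rewrite (negPf d0) (negPf w0).
have [e1 [e2 be]] := lattice_basis_ext3 subM bg hx hy hz prim.
have q0 : f (t * x *: g1 + t * y *: g2 + t * z *: g3)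
            (t * x *: g1 + t * y *: g2 + t * z *: g3) = 0.
  rewrite -!scalerA -!scalerDr -wE !(bilZl fP) !(bilZr fC fP) fw.
  by rewrite !mulr0.
move: be q0; move: (_ + _ + _) => e3 be f3.
clear x y z wE hx hy hz prim.
have {M1 M2 M3}[M1 M2 M3 _ gen] := be.
have npi1 : ~ vge v 1 1 by apply: (unit_not_p (oner_neq0 F) (v1 HF)).
(* If 2 f(e1, e3) and 2 f(e2, e3) were both in p, the isotropic vector e3 / pi could be adjoined to
   M. *)
have [f1 [f2 [bf n2]]] : exists f1 f2,
    lattice_basis M f1 f2 e3 /\ ~ vge v 1 (2%:R * f f2 e3).
  have [p2|n2] := EM (vge v 1 (2%:R * f e2 e3)); last by exists e1, e2.
  exists e2, e1; split.
    apply: (lattice_basis_change (u := -1) be) => //.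
    - by rewrite oppr_eq0 oner_neq0.
    - by rewrite (vN HF) (v1 HF).
    - by rewrite /detk; ring.
  move=> p1; apply: npi1.
  have [|_ _] := @lattice_basis_div_pi M e1 e2 e3 0 0 1 be; last by [].
  rewrite !scale0r !add0r scale1r; apply: (maximal_lattice_mem HF fC fP maxM).
    by rewrite (bilZl fP) (bilZr fC fP) f3 !mulr0; apply: vge0.
  move=> u /gen[x [y [z [hx hy hz ->]]]].
  rewrite (bilZr fC fP) !(bilDl fP) !(bilZl fP) f3.
  have -> : 2%:R * (pi^-1 * (x * f e1 e3 + y * f e2 e3 + z * 0)) =
    pi^-1 * (x * (2%:R * f e1 e3) + y * (2%:R * f e2 e3)) by ring.
  apply: (vge_div_pi HF Hpi); rewrite add0r.
  by apply: (vgeD HF); apply: (vgeMl HF).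
have {M1 M2 M3 gen}[M1 M2 M3 _ _] := bf.
have [b0 vb] := v_unit_of_not_p (B0 _ _ M2 M3) n2.
have hbi := vge0_inv HF (B0 _ _ M2 M3) n2.
set b := 2%:R * f f2 e3 in b0 vb hbi.
(* These coefficients make h1 = f1 + y f2 + z e3 orthogonal to f2 and e3: [y] kills the pairing with
   e3, then [z] the one with f2. They are integral because [b] is a unit. *)
pose y := - (2%:R * f f1 e3) / b.
pose z := - (2%:R * f f1 f2 + y * (2%:R * f f2 f2)) / b.
have hy : vge v 0 y by have := B0 _ _ M1 M3 => *; rewrite /y; vint HF.
have hz : vge v 0 z.
  have := B0 _ _ M1 M2; have := B0 _ _ M2 M2 => *.
  by rewrite /z; apply: (vgeMl HF) => //; vint HF.
pose h1 := 1 *: f1 + y *: f2 + z *: e3.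
have Mh : M h1 by apply: submod_comb => //; apply: (vge_1 HF).
have bh : lattice_basis M h1 f2 e3.
  apply: (lattice_basis_change (u := 1) bf) => //;
    rewrite ?oner_neq0 ?(v1 HF) //.
  by rewrite /h1 /detk !linearE /=; ring.
have [_ _ _ dh genh] := bh.
have h13 : f h1 e3 = 0.
  rewrite /h1 !(bilDl fP) !(bilZl fP) f3.
  apply: (mulfI two_neq0); rewrite /y.
  have -> : 2%:R * (1 * f f1 e3 + - (2%:R * f f1 e3) / b * f f2 e3 + z * 0) =
    2%:R * f f1 e3 + - (2%:R * f f1 e3) / b * b by rewrite /b; ring.
  by rewrite divfK // subrr mulr0.
have h12 : f h1 f2 = 0.
  rewrite /h1 !(bilDl fP) !(bilZl fP) (fC e3 f2).
  apply: (mulfI two_neq0).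
  have -> : 2%:R * (1 * f f1 f2 + y * f f2 f2 + z * f f2 e3) =
    2%:R * f f1 f2 + y * (2%:R * f f2 f2) + z * b by rewrite /b; ring.
  by rewrite /z divfK // subrr mulr0.
have hdE : half_det h1 f2 e3 = - (f h1 h1 * b ^+ 2).
  by rewrite /half_det h12 h13 f3 /b; ring.
have hd0 := half_det_neq0 dh.
have a0 : f h1 h1 != 0.
  by apply: contraNneq hd0 => e; rewrite hdE e mul0r oppr0.
exists h1, f2, e3; split=> //.
rewrite hdE (vN HF) (vM HF) ?expf_neq0 // (vX2 HF) // vb.
have := QM Mh a0; suff : ~ vge v 2 (f h1 h1) by rewrite (vge_eqP _ _ a0); lia.
(* Q[h1] in p^2 would allow h1 / pi, orthogonal to f2 and e3, to be adjoined to M. *)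
move=> p2; apply: npi1.
have [|? _ _] := @lattice_basis_div_pi M h1 f2 e3 1 0 0 bh; last by [].
rewrite !scale0r !addr0 scale1r; apply: (maximal_lattice_mem HF fC fP maxM).
  by rewrite (bilZl fP) (bilZr fC fP); do 2!apply: (vge_div_pi HF Hpi).
move=> u /genh[x' [y' [z' [hx' hy' hz' ->]]]].
rewrite (bilZr fC fP) !(bilDl fP) !(bilZl fP) (fC f2) (fC e3) h12 h13.
have -> : 2%:R * (pi^-1 * (x' * f h1 h1 + y' * 0 + z' * 0)) =
    pi^-1 * (2%:R * x' * f h1 h1) by ring.
apply: (vge_div_pi HF Hpi); apply: (vgeMl HF); first by vint HF.
by apply: vge_le p2.
Qed.

End MaximalTernary.

End TernarySpace.

(** * Ternary Clifford algebras *)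

Section CliffordMonomials.
Variables (F : fieldType) (A : algType F) (e1 e2 e3 : A).
Variables (q1 q2 q3 b12 b13 b23 : F).
Hypotheses (e11 : e1 * e1 = q1%:A) (e22 : e2 * e2 = q2%:A).
Hypothesis e33 : e3 * e3 = q3%:A.
Hypothesis e21 : e2 * e1 = b12%:A - e1 * e2.
Hypothesis e31 : e3 * e1 = b13%:A - e1 * e3.
Hypothesis e32 : e3 * e2 = b23%:A - e2 * e3.

(** The e_i stand for a g-basis of a lattice, so they are not assumed orthogonal; nor are the
    monomials assumed independent. *)
Definition even_mon (s a b c : F) : A :=
  s%:A + a *: (e1 * e2) + b *: (e1 * e3) + c *: (e2 * e3).

Definition odd_mon (a b c s : F) : A :=
  a *: e1 + b *: e2 + c *: e3 + s *: (e1 * e2 * e3).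

Lemma even_monD s a b c s' a' b' c' : even_mon s a b c + even_mon s' a' b' c' =
  even_mon (s + s') (a + a') (b + b') (c + c').
Proof.
rewrite /even_mon !scalerDl (addrACA (_ + _ + _)).
by rewrite (addrACA (_ + _) (b *: _)) (addrACA s%:A).
Qed.

Lemma odd_monD a b c s a' b' c' s' : odd_mon a b c s + odd_mon a' b' c' s' =
  odd_mon (a + a') (b + b') (c + c') (s + s').
Proof.
rewrite /odd_mon !scalerDl (addrACA (_ + _ + _)).
by rewrite (addrACA (_ + _) (c *: _)) (addrACA (a *: _)).
Qed.

Lemma even_monZ t s a b c :
  t *: even_mon s a b c = even_mon (t * s) (t * a) (t * b) (t * c).
Proof. by rewrite /even_mon !scalerDr !scalerA. Qed.

Lemma odd_monZ t a b c s :
  t *: odd_mon a b c s = odd_mon (t * a) (t * b) (t * c) (t * s).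
Proof. by rewrite /odd_mon !scalerDr !scalerA. Qed.

Let monE := (scale0r, scale1r, add0r, addr0, scaleN1r).

(** Together with its five companions below: the coefficients are polynomials in the q_i and b_ij
    with integer coefficients, so that, when these are integral, the g-span of the eight monomials
    is stable under left multiplication by each e_i. *)
Lemma mul_even_mon1 s a b c :
  e1 * even_mon s a b c = odd_mon s (q1 * a) (q1 * b) c.
Proof.
have m1 : e1 * (e1 * e2) = odd_mon 0 q1 0 0.
  by rewrite /odd_mon !monE mulrA e11 mulr_algl.
have m2 : e1 * (e1 * e3) = odd_mon 0 0 q1 0.
  by rewrite /odd_mon !monE mulrA e11 mulr_algl.
have m3 : e1 * (e2 * e3) = odd_mon 0 0 0 1 by rewrite /odd_mon !monE mulrA.
have m0 : e1 = odd_mon 1 0 0 0 by rewrite /odd_mon !monE.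
rewrite {1}/even_mon !mulrDr -!scalerAr mulr1 m1 m2 m3 {1}m0.
rewrite !odd_monZ !odd_monD; congr odd_mon; ring.
Qed.

Lemma mul_even_mon2 s a b c : e2 * even_mon s a b c =
  odd_mon (- q2 * a) (s + b12 * a) (b12 * b + q2 * c) (- b).
Proof.
have m1 : e2 * (e1 * e2) = odd_mon (- q2) b12 0 0.
  rewrite /odd_mon !monE mulrA e21 mulrBl -mulrA e22 mulr_algl mulr_algr.
  by rewrite scaleNr addrC.
have m2 : e2 * (e1 * e3) = odd_mon 0 0 b12 (-1).
  by rewrite /odd_mon !monE mulrA e21 mulrBl mulr_algl.
have m3 : e2 * (e2 * e3) = odd_mon 0 0 q2 0.
  by rewrite /odd_mon !monE mulrA e22 mulr_algl.
have m0 : e2 = odd_mon 0 1 0 0 by rewrite /odd_mon !monE.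
rewrite {1}/even_mon !mulrDr -!scalerAr mulr1 m1 m2 m3 {1}m0.
rewrite !odd_monZ !odd_monD; congr odd_mon; ring.
Qed.

Lemma mul_even_mon3 s a b c : e3 * even_mon s a b c =
  odd_mon (- b23 * a - q3 * b) (b13 * a - q3 * c) (s + b13 * b + b23 * c) a.
Proof.
have m1 : e3 * (e1 * e2) = odd_mon (- b23) b13 0 1.
  rewrite /odd_mon !monE mulrA e31 mulrBl mulr_algl -(mulrA e1 e3) e32.
  by rewrite mulrBr mulr_algr opprB mulrA scaleNr addrA addrC addrA.
have m2 : e3 * (e1 * e3) = odd_mon (- q3) 0 b13 0.
  rewrite /odd_mon !monE mulrA e31 mulrBl mulr_algl -mulrA e33.
  by rewrite mulr_algr scaleNr addrC.
have m3 : e3 * (e2 * e3) = odd_mon 0 (- q3) b23 0.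
  rewrite /odd_mon !monE mulrA e32 mulrBl mulr_algl -mulrA e33.
  by rewrite mulr_algr scaleNr addrC.
have m0 : e3 = odd_mon 0 0 1 0 by rewrite /odd_mon !monE.
rewrite {1}/even_mon !mulrDr -!scalerAr mulr1 m1 m2 m3 {1}m0.
rewrite !odd_monZ !odd_monD; congr odd_mon; ring.
Qed.

Lemma mul_odd_mon1 a b c s :
  e1 * odd_mon a b c s = even_mon (q1 * a) b c (q1 * s).
Proof.
have m1 : e1 * e1 = even_mon q1 0 0 0 by rewrite /even_mon !monE.
have m2 : e1 * e2 = even_mon 0 1 0 0 by rewrite /even_mon !monE.
have m3 : e1 * e3 = even_mon 0 0 1 0 by rewrite /even_mon !monE.
have m4 : e1 * (e1 * e2 * e3) = even_mon 0 0 0 q1.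
  by rewrite /even_mon !monE !mulrA e11 -mulrA mulr_algl.
rewrite {1}/odd_mon !mulrDr -!scalerAr m4 m1 m2 m3.
rewrite !even_monZ !even_monD; congr even_mon; ring.
Qed.

Lemma mul_odd_mon2 a b c s : e2 * odd_mon a b c s =
  even_mon (b12 * a + q2 * b) (- a) (- q2 * s) (c + b12 * s).
Proof.
have m1 : e2 * e1 = even_mon b12 (-1) 0 0 by rewrite /even_mon !monE.
have m2 : e2 * e2 = even_mon q2 0 0 0 by rewrite /even_mon !monE.
have m3 : e2 * e3 = even_mon 0 0 0 1 by rewrite /even_mon !monE.
have m4 : e2 * (e1 * e2 * e3) = even_mon 0 0 (- q2) b12.
  rewrite /even_mon !monE !mulrA e21 !mulrBl -!mulrA mulr_algl.
  by rewrite (mulrA e2) e22 mulr_algl -scalerAr scaleNr addrC.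
rewrite {1}/odd_mon !mulrDr -!scalerAr m4 m1 m2 m3.
rewrite !even_monZ !even_monD; congr even_mon; ring.
Qed.

Lemma mul_odd_mon3 a b c s : e3 * odd_mon a b c s =
  even_mon (b13 * a + b23 * b + q3 * c) (q3 * s) (- a - b23 * s)
           (- b + b13 * s).
Proof.
have m1 : e3 * e1 = even_mon b13 0 (-1) 0 by rewrite /even_mon !monE.
have m2 : e3 * e2 = even_mon b23 0 0 (-1) by rewrite /even_mon !monE.
have m3 : e3 * e3 = even_mon q3 0 0 0 by rewrite /even_mon !monE.
have m4 : e3 * (e1 * e2 * e3) = even_mon 0 q3 (- b23) b13.
  rewrite /even_mon !monE !mulrA e31 !mulrBl -!mulrA mulr_algl.
  rewrite (mulrA e3) e32 mulrBl mulr_algl -(mulrA e2) e33 mulr_algr.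
  rewrite mulrBr -!scalerAr opprB scaleNr.
  exact: addrC.
rewrite {1}/odd_mon !mulrDr -!scalerAr m4 m1 m2 m3.
rewrite !even_monZ !even_monD; congr even_mon; ring.
Qed.

End CliffordMonomials.

(** * Matrix units from a hyperbolic pair *)

Section HyperbolicMatrices.
Variables (F : fieldType) (A : algType F) (x y z : A) (u : F).
Hypotheses (xx : x * x = 0) (yy : y * y = 0) (zz : z * z = u%:A).
Hypotheses (yx : y * x = 1 - x * y) (zx : z * x = - (x * z)).
Hypotheses (zy : z * y = - (y * z)) (u_neq0 : u != 0).

(** A 2 by 2 matrix in disguise: xy and yx are complementary idempotents, xz and yz the off-diagonal
    units, up to the factor in (xz)(yz) = -u xy. *)
Definition hyp_mx (a b c d : F) : A :=
  a *: (x * y) + b *: (x * z) + c *: (y * z) + d *: (y * x).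

Lemma hyp_mxD a b c d a' b' c' d' : hyp_mx a b c d + hyp_mx a' b' c' d' =
  hyp_mx (a + a') (b + b') (c + c') (d + d').
Proof.
rewrite /hyp_mx !scalerDl (addrACA (_ + _ + _)).
by rewrite (addrACA (_ + _) (c *: _)) (addrACA (a *: _)).
Qed.

Lemma hyp_mxZ t a b c d :
  t *: hyp_mx a b c d = hyp_mx (t * a) (t * b) (t * c) (t * d).
Proof. by rewrite /hyp_mx !scalerDr !scalerA. Qed.

Let xyx : x * y * x = x.
Proof. by rewrite -mulrA yx mulrBr mulr1 mulrA xx mul0r subr0. Qed.

Let yxy : y * x * y = y.
Proof. by rewrite yx mulrBl mul1r -mulrA yy mulr0 subr0. Qed.

Let mul_xy a b c d : x * y * hyp_mx a b c d = hyp_mx a b 0 0.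
Proof.
rewrite /hyp_mx !mulrDr -!scalerAr !mulrA xyx -!(mulrA x y y) yy.
by rewrite !mulr0 !mul0r !scaler0 !scale0r.
Qed.

Let mul_yx a b c d : y * x * hyp_mx a b c d = hyp_mx 0 0 c d.
Proof.
rewrite /hyp_mx !mulrDr -!scalerAr !mulrA yxy -!(mulrA y x x) xx.
by rewrite !mulr0 !mul0r !scaler0 !scale0r !add0r.
Qed.

Let mul_xz a b c d : x * z * hyp_mx a b c d = hyp_mx (- u * c) d 0 0.
Proof.
have m1 : x * z * (x * y) = 0.
  by rewrite mulrA -(mulrA x z x) zx mulrN mulrA xx mul0r oppr0 mul0r.
have m2 : x * z * (x * z) = 0.
  by rewrite mulrA -(mulrA x z x) zx mulrN mulrA xx mul0r oppr0 mul0r.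
have m3 : x * z * (y * z) = - u *: (x * y).
  rewrite mulrA -(mulrA x z y) zy mulrN mulNr mulrA -(mulrA (x * y)) zz.
  by rewrite mulr_algr scaleNr.
have m4 : x * z * (y * x) = x * z.
  rewrite mulrA -(mulrA x z y) zy mulrN mulNr mulrA -(mulrA (x * y) z x) zx.
  by rewrite mulrN opprK mulrA xyx.
rewrite /hyp_mx !mulrDr -!scalerAr m1 m2 m3 m4.
by rewrite !scaler0 !add0r scalerA !scale0r !addr0 mulrC.
Qed.

Let mul_yz a b c d : y * z * hyp_mx a b c d = hyp_mx 0 0 a (- u * b).
Proof.
have m1 : y * z * (x * y) = y * z.
  rewrite mulrA -(mulrA y z x) zx mulrN mulNr mulrA -(mulrA (y * x) z y) zy.
  by rewrite mulrN opprK mulrA yxy.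
have m2 : y * z * (x * z) = - u *: (y * x).
  rewrite mulrA -(mulrA y z x) zx mulrN mulNr mulrA -(mulrA (y * x)) zz.
  by rewrite mulr_algr scaleNr.
have m3 : y * z * (y * z) = 0.
  by rewrite mulrA -(mulrA y z y) zy mulrN mulrA yy mul0r oppr0 mul0r.
have m4 : y * z * (y * x) = 0.
  by rewrite mulrA -(mulrA y z y) zy mulrN mulrA yy mul0r oppr0 mul0r.
rewrite /hyp_mx !mulrDr -!scalerAr m1 m2 m3 m4.
by rewrite !scaler0 !addr0 scalerA !scale0r !add0r mulrC.
Qed.

Lemma hyp_mxM a b c d a' b' c' d' : hyp_mx a b c d * hyp_mx a' b' c' d' =
  hyp_mx (a * a' - u * (b * c')) (a * b' + b * d') (c * a' + d * c')
         (d * d' - u * (c * b')).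
Proof.
rewrite {1}/hyp_mx !mulrDl -!scalerAl mul_xy mul_xz mul_yz mul_yx.
rewrite !hyp_mxZ !hyp_mxD; congr hyp_mx; ring.
Qed.

Lemma hyp_mx1 : hyp_mx 1 0 0 1 = 1.
Proof. by rewrite /hyp_mx !scale1r !scale0r !addr0 yx addrC subrK. Qed.

Let xy_neq0 : x * y != 0.
Proof.
apply/eqP => e; have x0 : x = 0 by rewrite -xyx e mul0r.
by move: yx; rewrite x0 !mulr0 mul0r subr0 => /esym/eqP; rewrite oner_eq0.
Qed.

Let yx_neq0 : y * x != 0.
Proof.
apply/eqP => e; have y0 : y = 0 by rewrite -yxy e mul0r.
by move: yx; rewrite y0 mulr0 mul0r subr0 => /esym/eqP; rewrite oner_eq0.
Qed.

Let ends_eq0 a d : hyp_mx a 0 0 d = 0 -> a = 0 /\ d = 0.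
Proof.
move=> h; have := mul_xy a 0 0 d; have := mul_yx a 0 0 d.
rewrite h !mulr0 /hyp_mx !scale0r !addr0 !add0r => /esym/eqP + /esym/eqP.
rewrite !scaler_eq0 (negPf xy_neq0) (negPf yx_neq0) !orbF.
by move=> /eqP-> /eqP->.
Qed.

(** Multiplication by matrix units on both sides brings each coefficient in turn to the diagonal,
    where [ends_eq0] applies. *)
Lemma hyp_mx_eq0 a b c d : hyp_mx a b c d = 0 ->
  [/\ a = 0, b = 0, c = 0 & d = 0].
Proof.
move=> h; have sandwich p r : p * hyp_mx a b c d * r = 0.
  by rewrite h mulr0 mul0r.
have eq0_of t : - u * t = 0 -> t = 0.
  by move/eqP; rewrite mulf_eq0 oppr_eq0 (negPf u_neq0) => /eqP.
have a0 : a = 0 /\ 0 = 0 :> F.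
  apply: ends_eq0; rewrite -(sandwich (hyp_mx 1 0 0 0) (hyp_mx 1 0 0 0)).
  by rewrite !hyp_mxM; congr hyp_mx; ring.
have b0 : - u * b = 0 /\ 0 = 0 :> F.
  apply: ends_eq0; rewrite -(sandwich (hyp_mx 1 0 0 0) (hyp_mx 0 0 1 0)).
  by rewrite !hyp_mxM; congr hyp_mx; ring.
have c0 : - u * c = 0 /\ 0 = 0 :> F.
  apply: ends_eq0; rewrite -(sandwich (hyp_mx 0 1 0 0) (hyp_mx 1 0 0 0)).
  by rewrite !hyp_mxM; congr hyp_mx; ring.
have d0 : 0 = 0 :> F /\ d = 0.
  apply: ends_eq0; rewrite -(sandwich (hyp_mx 0 0 0 1) (hyp_mx 0 0 0 1)).
  by rewrite !hyp_mxM; congr hyp_mx; ring.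
by split; [exact: a0.1|exact: eq0_of b0.1|exact: eq0_of c0.1|exact: d0.2].
Qed.

Lemma hyperbolic_matrices : exists m : {lrmorphism 'M[F]_2 -> A},
  injective m /\
  forall M : 'M[F]_2, m M = hyp_mx (M 0 0) (M 0 1) (- u^-1 * M 1 0) (M 1 1).
Proof.
pose g (M : 'M[F]_2) := hyp_mx (M 0 0) (M 0 1) (- u^-1 * M 1 0) (M 1 1).
have lin : linear g.
  move=> t M N; rewrite /g hyp_mxZ hyp_mxD !mxE; congr hyp_mx; ring.
have mulE (M N : 'M[F]_2) i j :
    (M *m N) i j = M i 0 * N 0 j + M i 1 * N 1 j.
  rewrite mxE !big_ord_recl big_ord0 addr0.
  by congr (_ + M i _ * N _ j); apply: val_inj.
have mon : monoid_morphism g.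
  split=> [|M N]; first by rewrite /g !mxE /= mulr0 hyp_mx1.
  rewrite /g hyp_mxM !mulE; congr hyp_mx; by field.
pose mL := GRing.isLinear.Build F 'M[F]_2 A *:%R g lin.
pose mM := GRing.isMonoidMorphism.Build 'M[F]_2 A g mon.
pose m : {lrmorphism 'M[F]_2 -> A} := HB.pack g mL mM.
exists m; split=> // M N /eqP; rewrite -subr_eq0 -raddfB => /eqP/hyp_mx_eq0.
case; rewrite !mxE => /eqP + /eqP + /eqP + /eqP.
rewrite mulf_eq0 oppr_eq0 invr_eq0 (negPf u_neq0) !subr_eq0.
move=> /eqP e1 /eqP e2 /eqP e3 /eqP e4; apply/matrixP => i j.
have I2 (k : 'I_2) : k = 0 \/ k = 1.
  by case: k => [[|[|//]] lt]; [left|right]; apply: val_inj.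
by case: (I2 i) (I2 j) => -> [] ->.
Qed.

End HyperbolicMatrices.

(** * The even Clifford algebra of a ternary space as a quaternion algebra *)

Section TernaryClifford.
Variables (F : fieldType) (U : vectType F) (f : U -> U -> F).
Variables (k1 k2 k3 : U) (X Y Z : {scalar U}).
Hypothesis coordE : forall w, w = X w *: k1 + Y w *: k2 + Z w *: k3.
Hypothesis coordk1 : [/\ X k1 = 1, Y k1 = 0 & Z k1 = 0].
Hypothesis coordk2 : [/\ X k2 = 0, Y k2 = 1 & Z k2 = 0].
Hypothesis coordk3 : [/\ X k3 = 0, Y k3 = 0 & Z k3 = 1].
Variables (a1 a2 a3 : F).
Hypothesis fE : forall x y,
  f x y = a1 * X x * X y + a2 * Y x * Y y + a3 * Z x * Z y.
Hypothesis two_neq0 : 2%:R != 0 :> F.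
Hypothesis disc_neq0 : a1 * a2 * a3 != 0.

Variables (A : algType F) (iota : {linear U -> A}).
Hypothesis HA : is_clifford_algebra f iota.
Variable star : {linear A -> A}.
Hypothesis Hstar : canonical_involution iota star.

Let fC x y : f x y = f y x. Proof. by rewrite !fE; ring. Qed.

Let fP a x y z : f (a *: x + y) z = a * f x z + f y z.
Proof. by rewrite !fE !linearP /=; ring. Qed.

Let a1_neq0 : a1 != 0.
Proof. by apply: contraNneq disc_neq0 => ->; rewrite !mul0r. Qed.

Let a2_neq0 : a2 != 0.
Proof. by apply: contraNneq disc_neq0 => ->; rewrite mulr0 mul0r. Qed.

Let a3_neq0 : a3 != 0.
Proof. by apply: contraNneq disc_neq0 => ->; rewrite mulr0. Qed.

Lemma scalar_inj (s t : F) : s%:A = t%:A :> A -> s = t.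
Proof.
by move/eqP; rewrite -subr_eq0 -scalerBl scaler_eq0 oner_eq0 orbF subr_eq0
  => /eqP.
Qed.

Lemma iota_sq x : iota x * iota x = (f x x)%:A.
Proof. by case: HA => + _; apply. Qed.

Lemma iota_anticomm x y : iota x * iota y + iota y * iota x = (2%:R * f x y)%:A.
Proof.
have := iota_sq (x + y).
rewrite linearD /= mulrDl !mulrDr !iota_sq.
have -> : f (x + y) (x + y) = f x x + 2%:R * f x y + f y y.
  by rewrite (bilDl fP) !(bilDr fC fP) (fC y x); ring.
rewrite !scalerDl -!addrA => /addrI; rewrite !addrA => /addIr.
exact.
Qed.

Lemma iota_swap x y : iota y * iota x = (2%:R * f x y)%:A - iota x * iota y.
Proof. by rewrite -iota_anticomm addrC addKr. Qed.

Let i := iota k1. Let j := iota k2. Let l := iota k3.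

Let f_k1 : f k1 k1 = a1 /\ f k1 k2 = 0.
Proof.
by case: coordk1 coordk2 => x1 y1 z1 [x2 y2 z2]; rewrite !fE x1 y1 z1 x2 y2 z2;
  split; ring.
Qed.

Let f_k2 : f k2 k2 = a2 /\ f k2 k3 = 0.
Proof.
by case: coordk2 coordk3 => x1 y1 z1 [x2 y2 z2]; rewrite !fE x1 y1 z1 x2 y2 z2;
  split; ring.
Qed.

Let f_k3 : f k3 k3 = a3 /\ f k1 k3 = 0.
Proof.
by case: coordk1 coordk3 => x1 y1 z1 [x2 y2 z2]; rewrite !fE x1 y1 z1 x2 y2 z2;
  split; ring.
Qed.

Let ii : i * i = a1%:A. Proof. by rewrite /i iota_sq f_k1.1. Qed.
Let jj : j * j = a2%:A. Proof. by rewrite /j iota_sq f_k2.1. Qed.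
Let ll : l * l = a3%:A. Proof. by rewrite /l iota_sq f_k3.1. Qed.
Let ji : j * i = - (i * j).
Proof. by rewrite /j /i iota_swap f_k1.2 mulr0 scale0r sub0r. Qed.
Let li : l * i = - (i * l).
Proof. by rewrite /l /i iota_swap f_k3.2 mulr0 scale0r sub0r. Qed.
Let lj : l * j = - (j * l).
Proof. by rewrite /l /j iota_swap f_k2.2 mulr0 scale0r sub0r. Qed.

Definition volume : A := iota k1 * iota k2 * iota k3.
Let xi := volume.

Let i_xi : i * xi = a1 *: (j * l) /\ xi * i = a1 *: (j * l).
Proof.
rewrite /xi /volume -/i -/j -/l; split.
  by rewrite !mulrA ii -mulrA mulr_algl.
by rewrite -mulrA li mulrN mulrA -(mulrA i j i) ji mulrN mulNr mulrA ii opprK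
  -mulrA mulr_algl.
Qed.

Let j_xi : j * xi = - a2 *: (i * l) /\ xi * j = - a2 *: (i * l).
Proof.
rewrite /xi /volume -/i -/j -/l; split.
  rewrite !mulrA ji mulNr -(mulrA i j j) jj mulr_algr mulNr -scalerAl.
  by rewrite scaleNr.
by rewrite -mulrA lj mulrN mulrA -(mulrA i j j) jj mulr_algr -scalerAl scaleNr.
Qed.

Let l_xi : l * xi = a3 *: (i * j) /\ xi * l = a3 *: (i * j).
Proof.
rewrite /xi /volume -/i -/j -/l; split; last by rewrite -mulrA ll mulr_algr.
by rewrite !mulrA li !mulNr -(mulrA i l j) lj mulrN mulNr opprK mulrA -mulrA ll
  mulr_algr.
Qed.

Lemma volume_central w : iota w * volume = volume * iota w.
Proof.
rewrite [w]coordE !linearD !linearZ /= !mulrDl !mulrDr -!scalerAl -!scalerAr.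
rewrite -/i -/j -/l -/xi i_xi.1 i_xi.2 j_xi.1 j_xi.2 l_xi.1 l_xi.2.
by [].
Qed.

Lemma volume_sq : volume * volume = (- (a1 * a2 * a3))%:A.
Proof.
rewrite {1}/volume -/i -/j -/l -(mulrA _ l) -/xi l_xi.1 -scalerAr.
rewrite -(mulrA i j (i * j)).
rewrite (mulrA j i j) ji mulNr -(mulrA i j j) jj mulr_algr mulrN -scalerAr ii.
by rewrite scalerN !scalerA -scaleNr; congr (_ *: _); ring.
Qed.

Let s1 : star 1 = 1.
Proof.
case: Hstar => sM sI _.
have h x : x = star 1 * x by rewrite -[x in LHS]sI -{1}[star x]mulr1 sM sI.
by rewrite -[LHS]mulr1 -h.
Qed.

Lemma star_scalar s : star s%:A = s%:A.
Proof. by rewrite linearZ /= s1. Qed.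

Lemma star_volume : star volume = - volume.
Proof.
case: Hstar => sM _ sU; rewrite /volume !sM !sU -/i -/j -/l.
by rewrite ji mulrN mulrA li mulNr opprK -(mulrA i l j) lj mulrN mulrA.
Qed.

(** Quaternion coordinates on the even part: the scalar part and the vector of the pure part. *)
Definition quat (s : F) (w : U) : A := s%:A + iota w * volume.

Lemma quatD s w t u : quat s w + quat t u = quat (s + t) (w + u).
Proof. by rewrite /quat linearD /= mulrDl scalerDl addrACA. Qed.

Lemma quatZ c s w : c *: quat s w = quat (c * s) (c *: w).
Proof. by rewrite /quat scalerDr scalerA linearZ /= -scalerAl. Qed.

Lemma quat0l w : quat 0 w = iota w * volume.
Proof. by rewrite /quat scale0r add0r. Qed.

Lemma quat0r s : quat s 0 = s%:A.
Proof. by rewrite /quat linear0 mul0r addr0. Qed.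

Lemma star_quat s w : star (quat s w) = quat s (- w).
Proof.
case: Hstar => sM _ sU; rewrite /quat linearD /= star_scalar sM sU star_volume.
by rewrite mulNr -volume_central linearN /= mulNr.
Qed.

(** The vector product of the quadratic space. The divisors come from k2 k3 = a1^-1 k1 xi and its
    cyclic analogues. *)
Definition cross (x y : U) : U :=
  ((Y x * Z y - Z x * Y y) / a1) *: k1 + ((Z x * X y - X x * Z y) / a2) *: k2
  + ((X x * Y y - Y x * X y) / a3) *: k3.

Lemma form_cross w x y : f w (cross x y) = detk X Y Z w x y.
Proof.
case: coordk1 coordk2 coordk3 => x1 y1 z1 [x2 y2 z2] [x3 y3 z3].
rewrite fE /cross !linearD !linearZ /= x1 y1 z1 x2 y2 z2 x3 y3 z3 /detk.
by field; rewrite a1_neq0 a2_neq0 a3_neq0.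
Qed.

Lemma iota_mul x y : iota x * iota y = quat (f x y) (cross x y).
Proof.
have e11 : i * i = quat a1 0 by rewrite quat0r.
have e22 : j * j = quat a2 0 by rewrite quat0r.
have e33 : l * l = quat a3 0 by rewrite quat0r.
have qk a w : quat 0 (a *: w) = a *: (iota w * xi).
  by rewrite quat0l linearZ /= -scalerAl.
have e12 : i * j = quat 0 (a3^-1 *: k3).
  by rewrite qk l_xi.1 scalerA mulVf // scale1r.
have e21 : j * i = quat 0 (- a3^-1 *: k3).
  by rewrite ji e12 -scaleN1r quatZ mulr0 scalerA mulN1r.
have e23 : j * l = quat 0 (a1^-1 *: k1).
  by rewrite qk i_xi.1 scalerA mulVf // scale1r.
have e32 : l * j = quat 0 (- a1^-1 *: k1).
  by rewrite lj e23 -scaleN1r quatZ mulr0 scalerA mulN1r.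
have e13 : i * l = quat 0 (- a2^-1 *: k2).
  by rewrite qk j_xi.1 scalerA mulrNN mulVf // scale1r.
have e31 : l * i = quat 0 (a2^-1 *: k2).
  by rewrite li e13 -scaleN1r quatZ mulr0 scalerA mulN1r opprK.
rewrite [x in LHS]coordE [y in LHS]coordE !linearD !linearZ /= -/i -/j -/l.
rewrite !mulrDl !mulrDr -!scalerAl -!scalerAr.
rewrite e11 e22 e33 e12 e21 e23 e32 e13 e31 !quatZ !quatD.
case: coordk1 coordk2 coordk3 => x1 y1 z1 [x2 y2 z2] [x3 y3 z3].
congr quat; first by rewrite fE; ring.
apply: (coord_inj coordE);
  rewrite /cross !linearD !linearZ !linear0 /=
    ?x1 ?y1 ?z1 ?x2 ?y2 ?z2 ?x3 ?y3 ?z3;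
  by field; rewrite ?a1_neq0 ?a2_neq0 ?a3_neq0.
Qed.

Lemma form_nondegenerate w : (forall x, f w x = 0) -> w = 0.
Proof.
move=> h; case: coordk1 coordk2 coordk3 => x1 y1 z1 [x2 y2 z2] [x3 y3 z3].
have := h k1; have := h k2; have := h k3; rewrite !fE.
rewrite x1 y1 z1 x2 y2 z2 x3 y3 z3 !mulr0 !mulr1 !addr0 !add0r.
move=> /eqP + /eqP + /eqP; rewrite !mulf_eq0 (negPf a1_neq0) (negPf a2_neq0).
rewrite (negPf a3_neq0) => /eqP hz /eqP hy /eqP hx.
by apply: (coord_inj coordE); rewrite ?linear0.
Qed.

(** Anticommutators of images recover 2 f, so the kernel of [iota] lies in the radical of f, which
    is zero. *)
Lemma iota_eq0 w : iota w = 0 -> w = 0.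
Proof.
move=> w0; apply: form_nondegenerate => x.
apply: (mulfI two_neq0); apply: scalar_inj.
by rewrite -iota_anticomm w0 mulr0 mul0r addr0 mulr0 scale0r.
Qed.

Lemma mul_volume_eq0 (x : A) : x * volume = 0 -> x = 0.
Proof.
move=> /(congr1 ( *%R^~ volume)); rewrite mul0r -mulrA volume_sq mulr_algr.
by move/eqP; rewrite scaler_eq0 oppr_eq0 (negPf disc_neq0) => /eqP.
Qed.

(** Adding the image under [star] isolates 2 s. Then w xi = 0 forces w = 0, since xi^2 is a nonzero
    scalar and [iota] is injective. *)
Lemma quat_eq0 s w : quat s w = 0 -> s = 0 /\ w = 0.
Proof.
move=> h; have := congr1 star h; rewrite star_quat linear0 => h'.
have s0 : s = 0.
  have : quat s w + quat s (- w) = 0 by rewrite h h' addr0.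
  rewrite quatD subrr quat0r -[0](scale0r 1) => /scalar_inj /eqP.
  by rewrite -mulr2n -mulr_natl mulf_eq0 (negPf two_neq0) => /eqP.
split=> //; apply: iota_eq0; apply: mul_volume_eq0.
by rewrite -quat0l -s0.
Qed.

Lemma quat_inj s w t u : quat s w = quat t u -> s = t /\ w = u.
Proof.
move=> h; have : quat s w + (-1) *: quat t u = 0.
  by rewrite h scaleN1r subrr.
rewrite quatZ quatD mulN1r scaleN1r => /quat_eq0[/eqP + /eqP].
by rewrite !subr_eq0 => /eqP-> /eqP->.
Qed.

Let c0 := a1 * a2 * a3.

Lemma pure_mul w u : quat 0 w * quat 0 u =
  quat (- c0 * f w u) (- c0 *: cross w u).
Proof.
rewrite !quat0l -(mulrA (iota w)) (mulrA volume) -volume_central.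
by rewrite -(mulrA (iota u)) volume_sq mulr_algr -scalerAr iota_mul quatZ.
Qed.

Lemma quat_mul s w t u : quat s w * quat t u =
  quat (s * t - c0 * f w u) (s *: u + t *: w - c0 *: cross w u).
Proof.
have tE r x : quat r x = r%:A + quat 0 x by rewrite /quat scale0r add0r.
rewrite (tE s w) (tE t u) [_ * (_ + _)]mulrDl [quat 0 w * _]mulrDr mulrDr.
rewrite !mulr_algl mulr_algr pure_mul -(quat0r t) !quatZ !quatD.
congr quat; first by ring.
by rewrite scaler0 add0r addrA scaleNr.
Qed.

Lemma crossC x y : cross x y = - cross y x.
Proof.
rewrite /cross !opprD -!scaleNr.
by congr (_ *: _ + _ *: _ + _ *: _); ring.
Qed.

(** The scalar [t] drops out because [star] negates w xi, and the pure parts of the two products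
    cancel by antisymmetry of [cross]. *)
Lemma nu_pure w t u : 2%:R *: nu star (quat 0 w) (quat t u) =
  (2%:R * c0 * f w u)%:A.
Proof.
have tE s x : quat s x = s%:A + quat 0 x by rewrite /quat scale0r add0r.
rewrite /nu scalerA mulfV // scale1r !star_quat (tE t u) (tE t (- u)).
rewrite [quat 0 w * _]mulrDr [_ * quat 0 (- w)]mulrDl mulr_algl mulr_algr.
rewrite !pure_mul !quatZ !mulr0 !quatD.
rewrite -[RHS]quat0r; congr quat.
  rewrite (fC u (- w)) -!scaleN1r (bilZl fP) (bilZr fC fP); ring.
have crossZr a x y : cross x (a *: y) = a *: cross x y.
  rewrite /cross !linearZ /= !scalerDr !scalerA.
  by congr (_ *: _ + _ *: _ + _ *: _); ring.
have crossNr a b : cross a (- b) = - cross a b.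
  by rewrite -scaleN1r crossZr scaleN1r.
by rewrite !crossNr (crossC u w) addrACA -!scalerDr !subrr !scaler0 addr0.
Qed.

Lemma even_cliffordE x : even_clifford iota x <-> exists s w, x = quat s w.
Proof.
split=> [|[s [w ->]]].
  pose E : set A := [set x | exists s w, x = quat s w].
  apply: (gspan_min (Y := E)) => [|_ [s es <-]].
    split=> [|_ _ [s [w ->]] [t [u ->]]|a _ _ [s [w ->]]].
    - by exists 0, 0; rewrite quat0r scale0r.
    - by rewrite quatD; exists (s + t), (w + u).
    - by rewrite quatZ; exists (a * s), (a *: w).
  (* Induction on the length, removing two vectors at a time. *)
  have [n] := ubnP (size s); elim: n s es => // n IH [|x1 [|x2 s]] //=.
    by move=> _ _; rewrite big_nil; exists 1, 0; rewrite quat0r scale1r.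
  rewrite negbK !ltnS => es le; rewrite !big_cons mulrA iota_mul.
  have [t [u ->]] := IH s es (ltnW le).
  by rewrite quat_mul; eexists; eexists.
have [_ ED EZ] := gspan_submodule setT
  [set \prod_(x <- s) iota x | s in [set s : seq U | ~~ odd (size s)]].
apply: ED.
  apply: EZ => //; apply: gspan_incl; exists [::] => //.
  by rewrite big_nil.
(* w xi is a product of four vectors, hence even. *)
apply: gspan_incl; exists [:: w; k1; k2; k3] => //.
by rewrite !big_cons big_nil mulr1 /volume !mulrA.
Qed.

Lemma pure_evenE x : pure_even iota star x <-> exists w, x = iota w * volume.
Proof.
split=> [[/even_cliffordE[s [w ->]]]|[w ->]].
  rewrite star_quat -(scaleN1r (quat s w)) quatZ mulN1r => /quat_inj[h _].
  exists w.
  rewrite -quat0l; congr quat; apply: (mulfI two_neq0).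
  by rewrite mulr0 mulr_natl mulr2n {1}h addNr.
split; first by apply/even_cliffordE; exists 0, w; rewrite quat0l.
by rewrite -quat0l star_quat -(scaleN1r (quat 0 w)) quatZ mulr0 scaleN1r.
Qed.

(** The universal property extends w -> -w to the grading automorphism, which will separate even
    monomials from odd ones. *)
Lemma clifford_parity : exists m : {lrmorphism A -> A},
  (forall x, m (iota x) = - iota x) /\
  forall x, even_clifford iota x -> m x = x.
Proof.
have lin : linear (fun x => - iota x).
  by move=> a x y; rewrite linearP opprD scalerN.
pose J := GRing.isLinear.Build F U A *:%R (fun x => - iota x) lin.
pose niota : {linear U -> A} := HB.pack (fun x => - iota x) J.
have nsq x : niota x * niota x = (f x x)%:A
  by rewrite /niota /= mulrNN iota_sq.
have [_ /(_ A niota nsq)[m mE _]] := HA.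
exists m; split=> // x /even_cliffordE[s [w ->]].
rewrite /quat /volume linearD linearZ /= !rmorphM /= rmorph1 !mE /niota /=.
by rewrite mulrNN mulrN mulrNN.
Qed.

Lemma even_mon_quat e1 e2 e3 s a b c :
  even_mon (iota e1) (iota e2) (iota e3) s a b c =
  quat (s + a * f e1 e2 + b * f e1 e3 + c * f e2 e3)
    (a *: cross e1 e2 + b *: cross e1 e3 + c *: cross e2 e3).
Proof. by rewrite /even_mon !iota_mul !quatZ -(quat0r s) !quatD add0r. Qed.

Lemma odd_mon_parity (m : {lrmorphism A -> A}) e1 e2 e3 a b c s :
  (forall x, m (iota x) = - iota x) ->
  m (odd_mon (iota e1) (iota e2) (iota e3) a b c s) =
  - odd_mon (iota e1) (iota e2) (iota e3) a b c s.
Proof.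
move=> mE; rewrite /odd_mon !linearD !linearZ /= !rmorphM /= !mE.
by rewrite mulrNN mulrN !scalerN.
Qed.

Variable v : F -> int.
Hypothesis HF : local_field v.

Section Order.
Variable L : set U.
Hypothesis QL : forall x, L x -> vge v 0 (f x x).
Variables e1 e2 e3 : U.
Hypothesis basisL : lattice_basis X Y Z v L e1 e2 e3.
Hypothesis subL : gsubmodule (integers v) L.

(** The g-span of the eight monomials contains 1 and is stable under left multiplication by L, as Q
    and 2 f are integral on L. Integrality is retained for the even coefficients, on which the
    pairing with pure quaternions depends. *)
Lemma clifford_order_mon y : clifford_order iota (integers v) L y ->
  exists s a b c a' b' c' s',
    [/\ vge v 0 s, vge v 0 a, vge v 0 b & vge v 0 c] /\
    y = even_mon (iota e1) (iota e2) (iota e3) s a b c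
      + odd_mon (iota e1) (iota e2) (iota e3) a' b' c' s'.
Proof.
have [L1 L2 L3 _ gen] := basisL; have [_ LD _] := subL.
have B0 x z : L x -> L z -> vge v 0 (2%:R * f x z).
  move=> Lx Lz.
  have -> : 2%:R * f x z = f (x + z) (x + z) - f x x - f z z.
    by rewrite (bilDl fP) !(bilDr fC fP) (fC z x); ring.
  have := QL (LD _ _ Lx Lz); have := QL Lx; have := QL Lz => *.
  by vint HF.
pose E := even_mon (iota e1) (iota e2) (iota e3).
pose O := odd_mon (iota e1) (iota e2) (iota e3).
pose T : set A := [set y | exists s a b c a' b' c' s',
  [/\ vge v 0 s, vge v 0 a, vge v 0 b & vge v 0 c] /\
  [/\ vge v 0 a', vge v 0 b', vge v 0 c' & vge v 0 s'] /\
  y = E s a b c + O a' b' c' s'].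
have TD y1 y2 : T y1 -> T y2 -> T (y1 + y2).
  move=> [s [a [b [c [a' [b' [c' [s' [[? ? ? ?] [[? ? ? ?] ->]]]]]]]]]].
  move=> [t [d [h [g [d' [h' [g' [t' [[? ? ? ?] [[? ? ? ?] ->]]]]]]]]]].
  rewrite /E /O addrACA even_monD odd_monD.
  do 8!eexists; split; last split; last by reflexivity.
    by split; vint HF.
  by split; vint HF.
have TZ k y1 : vge v 0 k -> T y1 -> T (k *: y1).
  move=> ? [s [a [b [c [a' [b' [c' [s' [[? ? ? ?] [[? ? ? ?] ->]]]]]]]]]].
  rewrite /E /O scalerDr even_monZ odd_monZ.
  do 8!eexists; split; last split; last by reflexivity.
    by split; vint HF.
  by split; vint HF.
have Tmul (e : A) : (forall s a b c, vge v 0 s -> vge v 0 a -> vge v 0 b ->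
      vge v 0 c -> exists a' b' c' s', [/\ vge v 0 a', vge v 0 b', vge v 0 c' &
      vge v 0 s'] /\ e * E s a b c = O a' b' c' s') ->
    (forall a b c s, vge v 0 a -> vge v 0 b -> vge v 0 c ->
      vge v 0 s -> exists s' a' b' c', [/\ vge v 0 s', vge v 0 a', vge v 0 b' &
      vge v 0 c'] /\ e * O a b c s = E s' a' b' c') ->
    forall y, T y -> T (e * y).
  move=> hE hO _ [s [a [b [c [a' [b' [c' [s' [+ [+ ->]]]]]]]]]].
  move=> [h1 h2 h3 h4] [g1 g2 g3 g4].
  have [p1 [p2 [p3 [p4 [hp eE]]]]] := hE _ _ _ _ h1 h2 h3 h4.
  have [r1 [r2 [r3 [r4 [hr eO]]]]] := hO _ _ _ _ g1 g2 g3 g4.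
  by exists r1, r2, r3, r4, p1, p2, p3, p4; rewrite mulrDr eE eO addrC.
have q1 := QL L1; have q2 := QL L2; have q3 := QL L3.
have b12 := B0 _ _ L1 L2; have b13 := B0 _ _ L1 L3; have b23 := B0 _ _ L2 L3.
have r1 := iota_sq e1; have r2 := iota_sq e2; have r3 := iota_sq e3.
have s21 := iota_swap e1 e2; have s31 := iota_swap e1 e3.
have s32 := iota_swap e2 e3.
have T1 z : T z -> T (iota e1 * z).
  apply: Tmul => *; rewrite (mul_even_mon1 _ _ r1, mul_odd_mon1 _ _ r1);
  by do 4!eexists; split; last reflexivity; split; vint HF.
have T2 z : T z -> T (iota e2 * z).
  apply: Tmul => *;
  rewrite (mul_even_mon2 _ r2 s21, mul_odd_mon2 _ r2 s21);
  by do 4!eexists; split; last reflexivity; split; vint HF.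
have T3 z : T z -> T (iota e3 * z).
  apply: Tmul => *;
  rewrite (mul_even_mon3 r3 s31 s32, mul_odd_mon3 r3 s31 s32);
  by do 4!eexists; split; last reflexivity; split; vint HF.
have T_1 : T 1.
  exists 1, 0, 0, 0, 0, 0, 0, 0.
  split; first by split; [exact: (vge_1 HF)|exact: vge0..].
  split; first by split; exact: vge0.
  by rewrite /E /O /even_mon /odd_mon !scale0r !addr0 scale1r.
(* S is a subring without knowing that T is closed under multiplication. *)
pose S : set A := [set x | forall y, T y -> T (x * y)].
suff yS : clifford_order iota (integers v) L `<=` S.
  move=> /yS/(_ 1 T_1); rewrite mulr1.
  move=> [s [a [b [c [a' [b' [c' [s' [h [_ ->]]]]]]]]]].
  by exists s, a, b, c, a', b', c', s'.
move=> x; apply; split; first split.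
- by move=> z; rewrite mul1r.
- move=> p r hp hr z Tz; rewrite mulrBl -scaleN1r.
  apply: TD; first exact: hp.
  by apply: TZ; [apply: (vgeN HF); apply: (vge_1 HF)|exact: hr].
- by move=> p r hp hr z Tz; rewrite -mulrA; apply: hp; apply: hr.
move=> _ [[a ha <-]|[w Lw <-]] z Tz.
  by rewrite mulr_algl; apply: TZ.
have [a [b [c [ha hb hc ->]]]] := gen w Lw.
rewrite !linearD !linearZ /= !mulrDl -!scalerAl.
by apply: (TD); [apply: (TD)|]; apply: TZ => //; auto.
Qed.

(** The pairing of w xi with a product a b is 2 c0 D(w, a, b) and with a scalar it is 0, so duality
    need only be tested on products of two basis vectors. *)
Lemma even_clifford_order_dual x :
  (order_dual iota (integers v) star
     (even_clifford_order iota (integers v) L) `&` pure_even iota star) x <->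
  exists w, [/\ x = iota w * volume,
    vge v 0 (2%:R * c0 * detk X Y Z w e2 e3),
    vge v 0 (2%:R * c0 * detk X Y Z e1 w e3) &
    vge v 0 (2%:R * c0 * detk X Y Z e1 e2 w)].
Proof.
have [L1 L2 L3 _ _] := basisL.
have perm1 w : detk X Y Z w e1 e2 = detk X Y Z e1 e2 w by rewrite /detk; ring.
have perm2 w : detk X Y Z w e1 e3 = - detk X Y Z e1 w e3.
  by rewrite /detk; ring.
split=> [[[_ dual] /pure_evenE[w xE]]|[w [-> h1 h2 h3]]].
  have mem a b : L a -> L b -> vge v 0 (2%:R * c0 * detk X Y Z w a b).
    move=> La Lb; have [|t ht] := dual (iota a * iota b).
      split; first by apply/even_cliffordE; rewrite iota_mul; do 2!eexists.
      move=> S [[_ _ SM] sub]; apply: SM; apply: sub; right.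
        by exists a.
      by exists b.
    rewrite xE -quat0l iota_mul nu_pure form_cross => /scalar_inj ->.
    exact: ht.
  exists w; split; rewrite -?perm1 //; try exact: mem.
  rewrite -[detk _ _ _ e1 w e3]opprK -perm2 mulrN.
  by apply: (vgeN HF); apply: mem.
split; last by apply/pure_evenE; exists w.
split; first by apply/even_cliffordE; exists 0, w; rewrite quat0l.
move=> y [ey /clifford_order_mon[s [a [b [c [a' [b' [c' [s' [+ yE]]]]]]]]]].
move=> [hs ha hb hc].
have [m [mi me]] := clifford_parity.
(* The grading automorphism fixes [y] and its even part but negates the odd part, so twice the odd
   part is 0. *)
have odd0 : odd_mon (iota e1) (iota e2) (iota e3) a' b' c' s' = 0.
  have := me y ey; rewrite {1}yE linearD /= (odd_mon_parity _ _ _ _ _ _ _ mi).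
  rewrite me; last by apply/even_cliffordE; rewrite even_mon_quat; do 2!eexists.
  rewrite yE => /addrI /eqP; rewrite eq_sym -subr_eq0 opprK -mulr2n -scaler_nat.
  by rewrite scaler_eq0 (negPf two_neq0) => /eqP.
rewrite yE odd0 addr0 even_mon_quat -quat0l nu_pure.
eexists; last reflexivity.
rewrite !(bilDr fC fP) !(bilZr fC fP) !form_cross perm1 perm2 /integers /=.
have -> : 2%:R * c0 * (a * detk X Y Z e1 e2 w + b * - detk X Y Z e1 w e3 +
    c * detk X Y Z w e2 e3) = a * (2%:R * c0 * detk X Y Z e1 e2 w) -
    b * (2%:R * c0 * detk X Y Z e1 w e3) +
    c * (2%:R * c0 * detk X Y Z w e2 e3) by ring.
by vint HF.
Qed.

End Order.

Lemma crossxx x : cross x x = 0.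
Proof.
rewrite /cross (mulrC (Z x)) (mulrC (Z x) (X x)) (mulrC (Y x) (X x)).
by rewrite !subrr !mul0r !scale0r !addr0.
Qed.

Lemma even_clifford_split_isotropic : even_clifford_split iota ->
  exists2 w, w != 0 & f w w = 0.
Proof.
case=> m m_inj m_range; pose n : 'M[F]_2 := delta_mx 0 1.
have nn : n * n = 0.
  by rewrite -[n * n]/(n *m n) /n mul_delta_mx_0.
have n0 : n != 0.
  by apply/eqP => /matrixP/(_ 0 1)/eqP; rewrite !mxE !eqxx oner_eq0.
have : even_clifford iota (m n) by rewrite -m_range; exists n.
move/even_cliffordE => [s [w mn]].
have mn0 : m n != 0 by rewrite -(rmorph0 m) (inj_eq m_inj).
have : m n * m n = 0 by rewrite -rmorphM nn rmorph0.
rewrite mn quat_mul crossxx scaler0 subr0 => /quat_eq0[/eqP + /eqP].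
rewrite -scalerDl -mulr2n -mulr_natl scaler_eq0 mulf_eq0 (negPf two_neq0) /=.
(* The square being 0 means 2 s w = 0 and s^2 = c0 f(w, w); w = 0 would give s = 0, hence a zero
   matrix. *)
have [w0 + _|w0 + /= /orP[/eqP s0|//]] := eqVneq w 0.
  rewrite w0 (bil0l fP) mulr0 subr0 mulf_eq0 orbb => /eqP s0.
  by move: mn0; rewrite mn s0 w0 quat0r scale0r eqxx.
rewrite s0 mul0r sub0r oppr_eq0 mulf_eq0 (negPf disc_neq0) => /eqP fw.
by exists w.
Qed.

(** Lagrange's identity, read off the scalar part of x y y x computed in two ways. *)
Lemma form_cross_sq x y :
  c0 * f (cross x y) (cross x y) = f x x * f y y - f x y ^+ 2.
Proof.
have : iota x * iota y * (iota y * iota x) = (f x x * f y y)%:A.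
  by rewrite -mulrA (mulrA (iota y)) !iota_sq mulr_algl -scalerAr iota_sq
    scalerA mulrC.
rewrite !iota_mul quat_mul (crossC y x) -(quat0r (f x x * f y y)).
move=> /quat_inj[<- _]; rewrite -scaleN1r (bilZr fC fP) (fC y x); ring.
Qed.

Lemma isotropic_even_clifford_split w : w != 0 -> f w w = 0 ->
  even_clifford_split iota.
Proof.
move=> w0 fw.
have [y0 wy0] : exists y, f w y != 0.
  apply: contrapT => none; move/eqP: w0; apply; apply: form_nondegenerate.
  by move=> x; apply/eqP/negP => /negP fx; apply: none; exists x.
(* Scaled so that w and [y1] have anticommutator 1. *)
pose y1 := (2%:R * f w y0)^-1 *: y0.
have wy1 : f w y1 = 2%:R^-1.
  by rewrite /y1 (bilZr fC fP); field; rewrite wy0 two_neq0.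
(* As f(w, y1) = 1/2, subtracting Q[y1] w makes the vector isotropic and leaves its pairing with w
   unchanged. *)
clearbody y1; pose y := y1 - f y1 y1 *: w.
have wy : f w y = 2%:R^-1.
  by rewrite /y (bilDr fC fP) -scaleNr (bilZr fC fP) fw mulr0 addr0.
have yy : f y y = 0.
  rewrite /y -scaleNr (bilDl fP) !(bilDr fC fP) !(bilZl fP) !(bilZr fC fP).
  by rewrite fw (fC y1 w) wy1; field.
clearbody y; pose z := cross w y.
have wz : f w z = 0 by rewrite form_cross /detk; ring.
have yz : f y z = 0 by rewrite form_cross /detk; ring.
have zz : f z z = - (4%:R * c0)^-1.
  apply: (mulfI disc_neq0); rewrite -/c0 form_cross_sq fw yy wy.
  rewrite /c0; field.
  by rewrite a1_neq0 a2_neq0 a3_neq0 (natrM F 2 2) mulf_neq0 ?two_neq0.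
have z0 : f z z != 0.
  by rewrite zz oppr_eq0 invr_eq0 mulf_neq0 // (natrM F 2 2) mulf_neq0.
have wyz : detk X Y Z w y z = f z z by rewrite [RHS]form_cross /detk; ring.
clearbody z.
have rww : iota w * iota w = 0 by rewrite iota_sq fw scale0r.
have ryy : iota y * iota y = 0 by rewrite iota_sq yy scale0r.
have ryw : iota y * iota w = 1 - iota w * iota y.
  by rewrite iota_swap wy mulfV // scale1r.
have rzw : iota z * iota w = - (iota w * iota z).
  by rewrite iota_swap wz mulr0 scale0r sub0r.
have rzy : iota z * iota y = - (iota y * iota z).
  by rewrite iota_swap yz mulr0 scale0r sub0r.
have [m [m_inj mE]] := hyperbolic_matrices rww ryy (iota_sq z) ryw rzw rzy z0.
exists m => //.
pose H := hyp_mx (iota w) (iota y) (iota z).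
(* The lower left entry undoes the factor -1/u in [hyperbolic_matrices], where u = f(z, z). *)
have mH a b c d : range m (H a b c d).
  exists (\matrix_(p, r) if p == 0 then (if r == 0 then a else b)
                         else (if r == 0 then - f z z * c else d)) => //.
  by rewrite mE !mxE /=; congr hyp_mx; field.
have RM p r : range m p -> range m r -> range m (p * r).
  by move=> [M _ <-] [N _ <-]; exists (M * N); rewrite ?rmorphM.
have RD p r : range m p -> range m r -> range m (p + r).
  by move=> [M _ <-] [N _ <-]; exists (M + N); rewrite ?raddfD.
have RZ c p : range m p -> range m (c *: p).
  by move=> [M _ <-]; exists (c *: M); rewrite ?linearZ.
have decomp p : exists a b c, p = a *: w + b *: y + c *: z.
  have := cramer coordE w y z p.
  rewrite wyz; move/(congr1 ( *:%R (f z z)^-1)).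
  rewrite scalerA mulVf // scale1r => pE.
  by rewrite !scalerDr !scalerA in pE; do 3!eexists; exact: pE.
(* w, y, z span the space, so nine products settle all products of two vectors, and these generate
   the even part. *)
have Rpair p r : range m (iota p * iota r).
  have [a [b [c ->]]] := decomp p; have [a' [b' [c' ->]]] := decomp r.
  have Hww : iota w * iota w = H 0 0 0 0.
    by rewrite rww /H /hyp_mx !scale0r !addr0.
  have Hyy : iota y * iota y = H 0 0 0 0.
    by rewrite ryy /H /hyp_mx !scale0r !addr0.
  have Hzz : iota z * iota z = H (f z z) 0 0 (f z z).
    rewrite iota_sq /H /hyp_mx !scale0r !addr0 -scalerDr ryw addrC subrK.
    by [].
  have Hwy : iota w * iota y = H 1 0 0 0.
    by rewrite /H /hyp_mx !(scale0r, scale1r, addr0, add0r).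
  have Hwz : iota w * iota z = H 0 1 0 0.
    by rewrite /H /hyp_mx !(scale0r, scale1r, addr0, add0r).
  have Hyz : iota y * iota z = H 0 0 1 0.
    by rewrite /H /hyp_mx !(scale0r, scale1r, addr0, add0r).
  have Hyw : iota y * iota w = H 0 0 0 1.
    by rewrite /H /hyp_mx !(scale0r, scale1r, addr0, add0r).
  have Hzw : iota z * iota w = H 0 (-1) 0 0.
    by rewrite rzw /H /hyp_mx !(scale0r, scaleN1r, addr0, add0r).
  have Hzy : iota z * iota y = H 0 0 (-1) 0.
    by rewrite rzy /H /hyp_mx !(scale0r, scaleN1r, addr0, add0r).
  rewrite !linearD !linearZ /= !mulrDl !mulrDr -!scalerAl -!scalerAr.
  rewrite Hww Hyy Hzz Hwy Hwz Hyz Hyw Hzw Hzy.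
  by rewrite /H !hyp_mxZ !hyp_mxD; exact: mH.
apply/seteqP; split=> [_ [M _ <-]|x /even_cliffordE[s [t ->]]].
  apply/even_cliffordE; rewrite mE /hyp_mx !iota_mul !quatZ !quatD.
  by do 2!eexists.
apply: RD; first by apply: RZ; exists 1; rewrite ?rmorph1.
by rewrite /volume !mulrA -mulrA; apply: RM.
Qed.

End TernaryClifford.

(** * Determinants and ideals *)

Lemma det_mx22 (R : comPzRingType) (M : 'M[R]_2) :
  \det M = M 0 0 * M 1 1 - M 0 1 * M 1 0.
Proof.
rewrite (expand_det_row _ ord0) !big_ord_recl big_ord0 addr0 /cofactor.
rewrite !det_mx11 !mxE /= expr0 expr1 mul1r mulN1r mulrN.
by congr (_ * M _ _ - M _ _ * M _ _); apply: val_inj.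
Qed.

Lemma det_mx33 (R : comPzRingType) (M : 'M[R]_3) : \det M =
  M 0 0 * (M 1 1 * M 2%:R 2%:R - M 1 2%:R * M 2%:R 1)
  - M 0 1 * (M 1 0 * M 2%:R 2%:R - M 1 2%:R * M 2%:R 0)
  + M 0 2%:R * (M 1 0 * M 2%:R 1 - M 1 1 * M 2%:R 0).
Proof.
rewrite (expand_det_row _ ord0) !big_ord_recl big_ord0 addr0 /cofactor.
rewrite !det_mx22 !mxE /= expr0 mul1r expr1 mulN1r mulrN sqrrN expr1n mul1r.
rewrite addrA.
by congr (_ * (M _ _ * M _ _ - M _ _ * M _ _) -
  M _ _ * (M _ _ * M _ _ - M _ _ * M _ _) +
  M _ _ * (M _ _ * M _ _ - M _ _ * M _ _)); apply: val_inj.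
Qed.

Section BasisDeterminant.
Variables (F : fieldType) (U : vectType F).

(** The two lengths are kept apart because [vbasis] is a tuple of length [\dim], which agrees with
    an explicit length only through the basis hypotheses. *)
Lemma det_change_basis (n m : nat) (b : n.-tuple U) (k : m.-tuple U)
    (g : 'End(U)) : basis_of {:U} b -> basis_of {:U} k ->
  \det (\matrix_(i, j) coord b j (g b`_i)) =
  \det (\matrix_(i, j) coord k j (g k`_i)).
Proof.
move=> bb bk.
have nm : n = m by rewrite -(size_basis bb) -(size_basis bk).
move: k bk; rewrite -nm => k bk.
pose P := \matrix_(i < n, j < n) coord k j b`_i.
pose Q := \matrix_(i < n, j < n) coord b j k`_i.
have PQ : P *m Q = 1%:M.
  apply/matrixP => i j; rewrite !mxE.
  rewrite -(coord_free i j (basis_free bb)).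
  rewrite [b`_i in RHS](coord_basis bk (memvf _)) linear_sum /=.
  by apply: eq_bigr => l _; rewrite !mxE linearZ.
have -> : \matrix_(i, j) coord b j (g b`_i) =
    P *m (\matrix_(i, j) coord k j (g k`_i)) *m Q.
  apply/matrixP => i j; rewrite !mxE.
  rewrite {1}[b`_i](coord_basis bk (memvf _)) !linear_sum /=.
  under [RHS]eq_bigr => l _ do rewrite !mxE mulr_suml.
  rewrite exchange_big /=; apply: eq_bigr => l _.
  rewrite !linearZ /= [g k`_l in LHS](coord_basis bk (memvf _)) linear_sum /=.
  rewrite mulr_sumr; apply: eq_bigr => r _.
  by rewrite !mxE linearZ /= mulrA.
by rewrite !det_mulmx mulrAC -det_mulmx PQ det1 mul1r.
Qed.

Lemma lfun_detE (m : nat) (k : m.-tuple U) (g : 'End(U)) :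
  basis_of {:U} k -> lfun_det g = \det (\matrix_(i, j) coord k j (g k`_i)).
Proof.
move=> bk; rewrite -(det_change_basis g (vbasisP fullv) bk) /lfun_det.
congr (\det _); apply/matrixP => i j.
rewrite !mxE /= -(passmx.vecof_delta (vbasis fullv)).
by rewrite passmx.coord_rVof.
Qed.

Lemma gram_det_comb (f : U -> U -> F) (n : nat) (e k : n.-tuple U) :
  (forall x y, f x y = f y x) ->
  (forall a x y z, f (a *: x + y) z = a * f x z + f y z) ->
  basis_of {:U} e -> exists s, gram_det f k = s ^+ 2 * gram_det f e.
Proof.
move=> fC fP be; pose P := \matrix_(i < n, j < n) coord e j (tnth k i).
exists (\det P); rewrite /gram_det.
have sumE (I : finType) (c : I -> F) (u : I -> U) z :
    f (\sum_i c i *: u i) z = \sum_i c i * f (u i) z.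
  elim/big_ind2: _ => [|x x' y y' <- <-|i _]; first exact: bil0l.
    exact: bilDl.
  exact: bilZl.
have -> : \matrix_(i, j) f (tnth k i) (tnth k j) =
    P *m (\matrix_(i, j) f (tnth e i) (tnth e j)) *m P^T.
  apply/matrixP => i j; rewrite !mxE.
  have kE l : tnth k l = \sum_r P l r *: tnth e r.
    rewrite [LHS](coord_basis be (memvf _)); apply: eq_bigr => r _.
    by rewrite mxE !(tnth_nth 0).
  rewrite (kE j) fC sumE; apply: eq_bigr => l _; rewrite !mxE mulrC.
  congr (_ * _); rewrite fC (kE i) sumE.
  by apply: eq_bigr => r _; rewrite !mxE.
by rewrite !det_mulmx det_tr; ring.
Qed.

End BasisDeterminant.

(** * Fractional ideals as powers of p *)

Section Balls.
Variables (F : fieldType) (v : F -> int).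
Hypothesis HF : local_field v.
Variable pi : F.
Hypothesis Hpi : prime_element v pi.

(** The ideal p^n, so that products of ideals become sums of exponents. *)
Definition ball (n : int) : set F := [set x | vge v n x].

Lemma ball_inj n m : ball n = ball m -> n = m.
Proof.
have half p r : ball p `<=` ball r -> r <= p.
  move=> sub; have [x x0 vx] := exists_v HF Hpi p.
  by have := sub x; rewrite /ball /= /vge vx => h; apply: h.
by move=> e; apply/eqP; rewrite eq_le !half // e.
Qed.

Lemma ball_submodule n : @gsubmodule F (integers v) F^o (ball n).
Proof.
split=> [|x y|a x]; [exact: vge0|exact: (vgeD HF)|exact: (vgeMl HF)].
Qed.

Lemma principal_ball (d : F) : d != 0 ->
  [set d * x | x in integers v] = ball (v d).
Proof.
move=> d0; apply/seteqP; split=> [_ [x hx <-]|y hy].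
  by have := (vgeM HF (@vge_v F v d) hx); rewrite addr0.
exists (d^-1 * y); last by rewrite mulrA mulfV // mul1r.
by have := vge_Vl HF d0 hy; rewrite subrr.
Qed.

Lemma ideal_mul_ball n m :
  ideal_mul (integers v) (ball n) (ball m) = ball (n + m).
Proof.
apply/seteqP; split=> [|y hy].
  apply: (@gspan_min F (integers v) F^o _ (ball _)).
    exact: ball_submodule.
  by move=> _ [a ha [x hx <-]]; apply: (vgeM HF).
have [a a0 va] := exists_v HF Hpi n.
apply: gspan_incl; exists a; first by rewrite -va; apply: vge_v.
exists (a^-1 * y); last by rewrite /GRing.scale /= mulrA mulfV // mul1r.
by have := vge_Vl HF a0 hy; rewrite va addrC addKr.
Qed.

Lemma gspan_bounded (s : seq F) :
  exists n, @gspan F (integers v) F^o [set x | x \in s] `<=` ball n.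
Proof.
suff [n hn] : exists n, forall x, x \in s -> vge v n x.
  exists n; apply: (@gspan_min F (integers v) F^o _ (ball _)) => //.
  exact: ball_submodule.
elim: s => [|x s [n hn]]; first by exists 0.
exists (Order.min n (v x)) => y; rewrite inE => /orP[/eqP->|/hn h].
  by apply: vge_le (@vge_v F v x); rewrite ge_min lexx orbT.
by apply: vge_le h; rewrite ge_min lexx.
Qed.

(** Finite generation bounds the valuations below, so the ideal has a nonzero element of least
    valuation, and this one generates it. *)
Lemma fractional_ideal_ball (I : set F) : fractional_ideal (integers v) I ->
  exists n, I = ball n.
Proof.
move=> [[s Is] [x Ix x0]].
have [_ _ IZ] : @gsubmodule F (integers v) F^o I.
  by rewrite Is; apply: gspan_submodule.
have [n hn] := gspan_bounded s; rewrite -Is in hn.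
pose P (m : nat) := `[< exists y, [/\ I y, y != 0 & v y = n + m%:Z] >].
have exP : exists m, P m.
  exists `|(v x - n)%R|%N; apply/asboolP; exists x; split=> //.
  by have := hn x Ix x0; lia.
have [m /asboolP[y [Iy y0 vy]] mmin] := ex_minnP exP.
exists (v y); apply/seteqP; split=> [z Iz z0|z hz].
  have := hn z Iz z0 => ge; suff /mmin : P `|(v z - n)%R|%N by lia.
  by apply/asboolP; exists z; split=> //; lia.
have -> : z = (z / y) *: (y : F^o) by rewrite /GRing.scale /= divfK.
by apply: IZ => //; have := vge_Vl HF y0 hz; rewrite subrr mulrC.
Qed.

Lemma lattice_scale (U : vectType F) (L : set U) w :
  lattice (integers v) L -> exists2 t, t != 0 & L (t *: w).
Proof.
move=> [[s ->] [X bX XL]]; set L' := gspan _ _ in XL *.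
have [L0 LD LZ] : gsubmodule (integers v) L' by apply: gspan_submodule.
have [n hn] : exists n, forall i : 'I_(size X),
    vge v n (coord (in_tuple X) i w).
  (* Any lower bound of the valuations will do, so the starting value 0 is harmless. *)
  exists (\big[Order.min/0]_(i < size X) v (coord (in_tuple X) i w)) => i.
  by apply: vge_le (@vge_v F v _); rewrite (bigD1 i) //= ge_min lexx.
have [t t0 vt] := exists_v HF Hpi (- n).
exists t => //.
have bX' : basis_of fullv (in_tuple X) by [].
rewrite (coord_basis bX' (memvf w)) scaler_sumr.
elim/big_ind: _ => // i _.
rewrite scalerA; apply: LZ; last by apply: XL; rewrite mem_nth.
have ht : vge v (- n) t by rewrite -vt; apply: vge_v.
by have := vgeM HF ht (hn i); rewrite addNr.
Qed.

End Balls.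

Section CoordinateFrame.
Variables (F : fieldType) (U : vectType F) (k1 k2 k3 : U).
Hypothesis k_basis : basis_of {:U} [tuple k1; k2; k3].

Let X : {scalar U} := coord [tuple k1; k2; k3] 0.
Let Y : {scalar U} := coord [tuple k1; k2; k3] 1.
Let Z : {scalar U} := coord [tuple k1; k2; k3] 2%:R.

Lemma frame_coordE w : w = X w *: k1 + Y w *: k2 + Z w *: k3.
Proof.
rewrite {1}(coord_basis k_basis (memvf w)) !big_ord_recl big_ord0 addr0 addrA.
by congr (_ *: _ + _ *: _ + _ *: _); congr (coord _ _ w); apply: val_inj.
Qed.

Lemma frame_coordk : [/\ [/\ X k1 = 1, Y k1 = 0 & Z k1 = 0],
  [/\ X k2 = 0, Y k2 = 1 & Z k2 = 0] & [/\ X k3 = 0, Y k3 = 0 & Z k3 = 1]].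
Proof.
have h (i j : 'I_3) := coord_free i j (basis_free k_basis).
by split; split; [exact: (h 0 0)|exact: (h 0 1)|exact: (h 0 2%:R)
  |exact: (h 1 0)|exact: (h 1 1)|exact: (h 1 2%:R)
  |exact: (h 2%:R 0)|exact: (h 2%:R 1)|exact: (h 2%:R 2%:R)].
Qed.

Lemma detk_lfun (g : 'End(U)) x y z :
  detk X Y Z (g x) (g y) (g z) = lfun_det g * detk X Y Z x y z.
Proof.
have gE w : g w = X w *: g k1 + Y w *: g k2 + Z w *: g k3.
  by rewrite {1}[w]frame_coordE !linearD !linearZ.
rewrite (gE x) (gE y) (gE z) detk_comb (lfun_detE g k_basis) det_mx33 !mxE.
by rewrite /detk /X /Y /Z /=; ring.
Qed.

Variable v : F -> int.
Hypothesis HF : local_field v.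

(** A map of M into L multiplies D(m) by its determinant, and the product must lie in D(e) g; the
    map taking each m_i to e_i has determinant D(e) / D(m) and generates. *)
Lemma lattice_index_ball (M L : set U) m1 m2 m3 e1 e2 e3 :
  gsubmodule (integers v) L ->
  lattice_basis X Y Z v M m1 m2 m3 -> lattice_basis X Y Z v L e1 e2 e3 ->
  lattice_index (integers v) M L =
    ball v (v (detk X Y Z e1 e2 e3) - v (detk X Y Z m1 m2 m3)).
Proof.
move=> subL bm be; have [M1 M2 M3 dm genM] := bm.
have [L1 L2 L3 de genL] := be.
set D := detk X Y Z e1 e2 e3 in de *; set d := detk X Y Z m1 m2 m3 in dm *.
apply/seteqP; split.
  apply: (@gspan_min F (integers v) F^o _ (ball v _)).
    exact: ball_submodule.
  move=> _ [g [_ gML] <-]; apply/(vge_mulP HF _ _ dm).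
  rewrite subrK mulrC -detk_lfun; apply: (detk_lattice_ge HF be); exact: gML.
pose h w := (d^-1 * detk X Y Z w m2 m3) *: e1
  + (d^-1 * detk X Y Z m1 w m3) *: e2 + (d^-1 * detk X Y Z m1 m2 w) *: e3.
have lin : linear h.
  move=> t x y; apply: (coord_inj frame_coordE);
    by rewrite /h /detk !(linearD, linearZ) /=; ring.
pose hL := GRing.isLinear.Build F U U *:%R h lin.
pose hl : {linear U -> U} := HB.pack h hL.
pose g := linfun hl.
have hm x y z : h (x *: m1 + y *: m2 + z *: m3) = x *: e1 + y *: e2 + z *: e3.
  rewrite /h; congr (_ *: _ + _ *: _ + _ *: _); apply: (mulfI dm);
    rewrite mulVKf // /d /detk !linearE /=; ring.
have g1 : g m1 = e1.
  have := hm 1 0 0; rewrite !scale0r !scale1r !addr0 => e.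
  by rewrite lfunE /= e.
have g2 : g m2 = e2.
  have := hm 0 1 0; rewrite !scale0r !scale1r !addr0 !add0r => e.
  by rewrite lfunE /= e.
have g3 : g m3 = e3.
  have := hm 0 0 1; rewrite !scale0r !scale1r !add0r => e.
  by rewrite lfunE /= e.
have dg : lfun_det g = D / d.
  by rewrite -[LHS](mulfK dm) -detk_lfun g1 g2 g3.
have dg0 : lfun_det g != 0 by rewrite dg mulf_neq0 ?invr_neq0.
have vg : v (lfun_det g) = v D - v d.
  by rewrite dg (vM HF) ?invr_neq0 // (vV HF).
have ker_g : lker g = 0%VS.
  apply/eqP; rewrite -subv0; apply/subvP => w.
  rewrite memv_ker memv0 => /eqP gw.
  (* A kernel vector has zero determinant with every pair, and its coordinates are such
     determinants. *)
  have dw y z : detk X Y Z w y z = 0.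
    apply: (mulfI dg0); rewrite -detk_lfun gw mulr0.
    by rewrite /detk !linear0 !mul0r; ring.
  have [[x1 y1 z1] [x2 y2 z2] [x3 y3 z3]] := frame_coordk.
  apply/eqP; apply: (coord_inj frame_coordE); rewrite linear0.
  - by rewrite -(dw k2 k3) /detk x2 y2 z2 x3 y3 z3; ring.
  - by rewrite -(dw k3 k1) /detk x3 y3 z3 x1 y1 z1; ring.
  - by rewrite -(dw k1 k2) /detk x1 y1 z1 x2 y2 z2; ring.
have gML x : M x -> L (g x).
  move=> /genM[a [b [c [ha hb hc ->]]]]; rewrite !linearD !linearZ /= g1 g2 g3.
  by apply: (submod_comb subL).
move=> y hy; have -> : y = (y / lfun_det g) *: (lfun_det g : F^o).
  by rewrite /GRing.scale /= divfK.
have [_ _ IZ] := gspan_submodule (integers v)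
  ([set lfun_det a | a in [set a : 'End(U) | lker a = 0%VS /\
     (forall x, M x -> L (a x))]] : set F^o).
apply: IZ; last by apply: gspan_incl; exists g.
by have := vge_Vl HF dg0 hy; rewrite vg subrr mulrC.
Qed.

End CoordinateFrame.

(** * Exact half-discriminants, and a lattice compared with the dual of its order *)

Section Scaling.
Variables (F : fieldType) (U : vectType F) (f : U -> U -> F).
Variables (k1 k2 k3 : U) (X Y Z : {scalar U}).
Hypothesis coordE : forall w, w = X w *: k1 + Y w *: k2 + Z w *: k3.
Hypothesis coordk1 : [/\ X k1 = 1, Y k1 = 0 & Z k1 = 0].
Hypothesis coordk2 : [/\ X k2 = 0, Y k2 = 1 & Z k2 = 0].
Hypothesis coordk3 : [/\ X k3 = 0, Y k3 = 0 & Z k3 = 1].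
Variables (a1 a2 a3 : F).
Hypothesis fE : forall x y,
  f x y = a1 * X x * X y + a2 * Y x * Y y + a3 * Z x * Z y.
Hypothesis two_neq0 : 2%:R != 0 :> F.
Hypothesis disc_neq0 : a1 * a2 * a3 != 0.
Variable v : F -> int.
Hypothesis HF : local_field v.
Variable pi : F.
Hypothesis Hpi : prime_element v pi.

(** The half-discriminant is c0 times a square, so the parity of v(c0) selects one value among 0, 1
    or among 1, 2. It passes from the basis found earlier to the given one because v([detk]) is the
    same for all bases of M. *)
Lemma maximal_half_det (M : set U) m1 m2 m3 :
  maximal_lattice (integers v) f M -> lattice_basis X Y Z v M m1 m2 m3 ->
  v (a1 * a2 * a3) = 0 \/ v (a1 * a2 * a3) = 1 ->
  ((exists2 w, w != 0 & f w w = 0) ->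
     v (half_det f m1 m2 m3) = v (a1 * a2 * a3)) /\
  (~ (exists2 w, w != 0 & f w w = 0) ->
     v (half_det f m1 m2 m3) = 2 - v (a1 * a2 * a3)).
Proof.
move=> maxM bm disc01; have [_ _ _ dm _] := bm.
have hm := v_half_det fE HF two_neq0 disc_neq0 dm.
have exM : exists m1 m2 m3, lattice_basis X Y Z v M m1 m2 m3.
  by exists m1, m2, m3.
split=> [[w w0 fw]|aniso].
  have [g1 [g2 [g3 [bg hg]]]] := isotropic_half_det coordE fE HF two_neq0
    disc_neq0 Hpi maxM w0 fw exM.
  have [_ _ _ dg _] := bg.
  have := v_half_det fE HF two_neq0 disc_neq0 dg.
  have := v_detk_lattice_basis HF two_neq0 disc_neq0 bm bg.
  by lia.
have aniso' x : f x x = 0 -> x = 0.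
  move=> fx; apply/eqP; apply: contraT => x0; case: aniso; by exists x.
have [g1 [g2 [g3 [bg hg]]]] := anisotropic_half_det coordE fE HF Hpi maxM
  aniso' exM.
have [_ _ _ dg _] := bg.
have := v_half_det fE HF two_neq0 disc_neq0 dg.
have := v_detk_lattice_basis HF two_neq0 disc_neq0 bm bg.
by lia.
Qed.

Variables (A : algType F) (iota : {linear U -> A}).
Hypothesis HA : is_clifford_algebra f iota.
Variable star : {linear A -> A}.
Hypothesis Hstar : canonical_involution iota star.

(** By Cramer's rule L is cut out by integrality of D(w, e2, e3) / D(e) and its analogues, and the
    dual by integrality of 2 c0 D(w, e2, e3) and its analogues. *)
Lemma lattice_volume_dual (L : set U) e1 e2 e3 :
  (forall x, L x -> vge v 0 (f x x)) -> gsubmodule (integers v) L ->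
  lattice_basis X Y Z v L e1 e2 e3 ->
  [set iota x * volume k1 k2 k3 iota | x in L] =
  gmul (integers v) (ball v (v (2%:R * (a1 * a2 * a3) * detk X Y Z e1 e2 e3)))
    (order_dual iota (integers v) star
       (even_clifford_order iota (integers v) L) `&` pure_even iota star).
Proof.
move=> QL subL be; have [L1 L2 L3 de gen] := be.
have dualP := even_clifford_order_dual coordE coordk1 coordk2 coordk3 fE
  two_neq0 disc_neq0 HA Hstar HF QL be subL.
set D := detk X Y Z e1 e2 e3 in de *; set d := 2%:R * (a1 * a2 * a3) in dualP *.
have d0 : d != 0 by rewrite mulf_neq0.
have dD0 : d * D != 0 by rewrite mulf_neq0.
apply/seteqP; split=> [_ [w Lw <-]|].
  apply: gspan_incl; exists (d * D); first exact: vge_v.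
  exists (iota ((d * D)^-1 *: w) * volume k1 k2 k3 iota); last first.
    by rewrite linearZ /= -scalerAl scalerA mulfV // scale1r.
  apply/dualP; exists ((d * D)^-1 *: w).
  have [x [y [z [hx hy hz ->]]]] := gen w Lw.
  have cancel_dD s : d * ((d * D)^-1 * s * D) = s by field; rewrite d0 de.
  pose w' := x *: e1 + y *: e2 + z *: e3.
  have c1 t : detk X Y Z (t *: w') e2 e3 = t * x * D.
    by rewrite /w' /D /detk !linearE /=; ring.
  have c2 t : detk X Y Z e1 (t *: w') e3 = t * y * D.
    by rewrite /w' /D /detk !linearE /=; ring.
  have c3 t : detk X Y Z e1 e2 (t *: w') = t * z * D.
    by rewrite /w' /D /detk !linearE /=; ring.
  by split=> //; rewrite ?c1 ?c2 ?c3 cancel_dD.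
have [L0 LD LZ] := subL.
apply: gspan_min => [|_ [t ht [x /dualP[w [-> h1 h2 h3]] <-]]].
  split=> [|_ _ [x Lx <-] [y Ly <-]|t _ ht [x Lx <-]].
  - by exists 0; rewrite ?linear0 ?mul0r.
  - by exists (x + y); [exact: LD|rewrite linearD mulrDl].
  - by exists (t *: x); [exact: LZ|rewrite linearZ /= scalerAl].
exists (t *: w); last by rewrite linearZ /= scalerAl.
have scale s : vge v 0 (d * s) -> vge v 0 (t * (s / D)).
  move=> hs.
  have -> : t * (s / D) = (d * D)^-1 * (t * (d * s)) by field; rewrite d0 de.
  have := vge_Vl HF dD0 (vgeM HF ht hs); rewrite addr0 subrr.
  exact.
have -> : t *: w = (t * (detk X Y Z w e2 e3 / D)) *: e1 +
    (t * (detk X Y Z e1 w e3 / D)) *: e2 +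
    (t * (detk X Y Z e1 e2 w / D)) *: e3.
  apply: (scalerI de); rewrite !scalerDr !scalerA.
  have cancelD s : D * (t * (s / D)) = t * s by field.
  have cw := cramer coordE e1 e2 e3 w; rewrite -/D in cw.
  by rewrite !cancelD (mulrC D t) -(scalerA t D w) cw !scalerDr !scalerA.
by apply: (submod_comb subL) => //; apply: scale.
Qed.

End Scaling.

Theorem theorem2p3
  (F : fieldType) (v : F -> int)
  (HF : local_field v) (charF : [pchar F] =i pred0)
  (pi : F) (Hpi : prime_element v pi)
  (V : vectType F) (phi : {symmetric V})
  (dimV : \dim {:V} = 4%N) (phi_nd : nondegenerate phi)
  (h : V) (q : F) (phi_h : phi h h = q) (q_neq0 : q != 0)
  (W : {vspace V}) (defW : W = orthov phi <[h]>%VS)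
  (psi : subvs_of W -> subvs_of W -> F) (defpsi : psi = restr_form phi W)
  (A : algType F) (iota : {linear subvs_of W -> A})
  (HA : is_clifford_algebra psi iota)
  (star : {linear A -> A}) (Hstar : canonical_involution iota star)
  (k1 k2 k3 : subvs_of W)
  (k_basis : basis_of {:subvs_of W} [:: k1; k2; k3])
  (k_orth : [/\ psi k1 k2 = 0, psi k1 k3 = 0 & psi k2 k3 = 0])
  (xi : A) (defxi : xi = iota k1 * iota k2 * iota k3)
  (xi_norm : exists2 c : F,
     (integer_units v `|` [set pi * u | u in integer_units v]) c
     & xi * star xi = c%:A)
  (e : 4.-tuple V) (e_basis : basis_of {:V} e)
  (delta : F) (defdelta : delta = gram_det phi e)
  (a b : set F)
  (Ha : a = integers v \/ a = prime_ideal v)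
  (Hb : fractional_ideal (integers v) b)
  (Hab : [set delta * q * x | x in integers v]
         = ideal_mul (integers v) a (ideal_mul (integers v) b b))
  (c : set F)
  (c_split : even_clifford_split iota -> c = a)
  (c_nonsplit : ~ even_clifford_split iota -> c = prime_ideal v)
  (L : set V) (HL : maximal_lattice (integers v) phi L)
  (M : set (subvs_of W)) (HM : maximal_lattice (integers v) psi M) :
  let LW : set (subvs_of W) := [set x | L (vsval x)] in
  [set iota x * xi | x in LW]
  = gmul (integers v)
      (ideal_mul (integers v) c (lattice_index (integers v) M LW))
      (order_dual iota (integers v) star
         (even_clifford_order iota (integers v) LW)
       `&` pure_even iota star).
Proof.
move=> LW.
have two_neq0 : 2%:R != 0 :> F.
  by have /pcharf0P -> := charF.
have phiC x y : phi x y = phi y x by rewrite hermC expr0 mul1r.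
have phiP t x y z : phi (t *: x + y) z = t * phi x z + phi y z.
  exact: linearPl.
have fC x y : psi x y = psi y x by rewrite defpsi /restr_form phiC.
have fP t x y z : psi (t *: x + y) z = t * psi x z + psi y z.
  by rewrite defpsi /restr_form linearP phiP.
have kB : basis_of {:subvs_of W} [tuple k1; k2; k3] by [].
pose X : {scalar subvs_of W} := coord [tuple k1; k2; k3] 0.
pose Y : {scalar subvs_of W} := coord [tuple k1; k2; k3] 1.
pose Z : {scalar subvs_of W} := coord [tuple k1; k2; k3] 2%:R.
have coordE : forall w, w = X w *: k1 + Y w *: k2 + Z w *: k3.
  exact: frame_coordE.
have [c1 c2 c3] := frame_coordk kB.
pose a1 := psi k1 k1; pose a2 := psi k2 k2; pose a3 := psi k3 k3.
have fE x y : psi x y = a1 * X x * X y + a2 * Y x * Y y + a3 * Z x * Z y.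
  have [o12 o13 o23] := k_orth.
  rewrite {1}[x]coordE {1}[y]coordE !(bilDl fP) !(bilDr fC fP) !(bilZl fP).
  rewrite !(bilZr fC fP) (fC k2 k1) (fC k3 k1) (fC k3 k2) o12 o13 o23.
  by rewrite /a1 /a2 /a3; ring.
have volE : xi = volume k1 k2 k3 iota by [].
pose c0 := a1 * a2 * a3.
(* Since star xi = -xi and xi^2 = -c0, the normalization of xi bears directly on c0. *)
have [disc_neq0 disc01] : c0 != 0 /\ (v c0 = 0 \/ v c0 = 1).
  have [d hd] := xi_norm.
  rewrite volE (star_volume c1 c2 c3 fE HA Hstar) mulrN.
  rewrite (volume_sq c1 c2 c3 fE HA) scaleNr opprK => /scalar_inj e0.
  have unitv x : integer_units v x -> x != 0 /\ v x = 0.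
    case=> hx x0 hxi; split=> //.
    have := hx x0; have := hxi (invr_neq0 x0); rewrite (vV HF) //.
    by move: (v x); clear; lia.
  rewrite /c0 e0; case: hd => [/unitv[d0 vd]|[u /unitv[u0 vu] <-]].
    by split=> //; left.
  split; first by rewrite mulf_neq0 ?(pi_neq0 Hpi).
  by right; rewrite (vM HF) ?(pi_neq0 Hpi) // (v_pi Hpi) vu.
have [phiL [latL QL]] : gsubmodule (integers v) L /\ lattice (integers v) L /\
    (forall x, L x -> vge v 0 (phi x x)).
  case: HL => -[lL QL] maxL; split=> //.
  by apply: (@integral_submodule _ _ _ phi L); split.
have subLW : gsubmodule (integers v) LW.
  have [L0 LD LZ] := phiL; split; rewrite /LW /=.
  - exact: L0.
  - by move=> x y; apply: LD.
  - by move=> t x; apply: LZ.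
have QLW x : LW x -> vge v 0 (psi x x).
  by move=> Lx; rewrite defpsi; apply: QL.
have [subM QM] : gsubmodule (integers v) M /\
    (forall x, M x -> vge v 0 (psi x x)).
  by case: HM => intM _; split; [apply: integral_submodule intM|case: intM].
have detk_scaled t1 t2 t3 : t1 != 0 -> t2 != 0 -> t3 != 0 ->
    detk X Y Z (t1 *: k1) (t2 *: k2) (t3 *: k3) != 0.
  case: c1 c2 c3 => x1 y1 z1 [x2 y2 z2] [x3 y3 z3] t10 t20 t30.
  rewrite /detk !linearZ /= /X /Y /Z /= x1 y1 z1 x2 y2 z2 x3 y3 z3.
  rewrite !(mulr0, mulr1, mul0r, subr0, addr0, oppr0).
  by rewrite !mulf_neq0.
(* Nonzero multiples of k1, k2, k3 lie in L, so its section by W spans W. *)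
have [e1 [e2 [e3 be]]] : exists e1 e2 e3, lattice_basis X Y Z v LW e1 e2 e3.
  have [t1 t10 L1] := lattice_scale HF Hpi (vsval k1) latL.
  have [t2 t20 L2] := lattice_scale HF Hpi (vsval k2) latL.
  have [t3 t30 L3] := lattice_scale HF Hpi (vsval k3) latL.
  apply: (exists_lattice_basis coordE fE HF two_neq0 disc_neq0 subLW QLW
    _ _ _ (detk_scaled _ _ _ t10 t20 t30)).
  - exact: L1.
  - exact: L2.
  - exact: L3.
have [m1 [m2 [m3 bm]]] : exists m1 m2 m3, lattice_basis X Y Z v M m1 m2 m3.
  have latM : lattice (integers v) M by case: HM => -[].
  have [t1 t10 L1] := lattice_scale HF Hpi k1 latM.
  have [t2 t20 L2] := lattice_scale HF Hpi k2 latM.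
  have [t3 t30 L3] := lattice_scale HF Hpi k3 latM.
  exact: (exists_lattice_basis coordE fE HF two_neq0 disc_neq0 subM QM
    L1 L2 L3 (detk_scaled _ _ _ t10 t20 t30)).
(* The Gram determinant of h, k1, k2, k3 is q c0 and equals delta times a square, so the exponent of
   a and v(c0) have the same parity; both are 0 or 1. *)
have a_ball : a = ball v (v c0).
  have [s gramE] : exists s, q * c0 = s ^+ 2 * delta.
    pose e' := [tuple h; vsval k1; vsval k2; vsval k3].
    have [s gE] := gram_det_comb e' phiC phiP e_basis.
    exists s; rewrite defdelta -gE /gram_det.
    have hW (x : subvs_of W) : phi (vsval x) h = 0.
      by apply/eqP; rewrite -mem_orthov1 -defW subvsP.
    have phik (x y : subvs_of W) : phi (vsval x) (vsval y) = psi x y.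
      by rewrite defpsi.
    have [o12 o13 o23] := k_orth.
    pose D : 'rV[F]_4 := \row_i [:: q; a1; a2; a3]`_i.
    have -> : \matrix_(i, j) phi (tnth e' i) (tnth e' j) = diag_mx D.
      apply/matrixP => i j; rewrite !mxE !(tnth_nth 0).
      case: i => [[|[|[|[|//]]]] ?]; case: j => [[|[|[|[|//]]]] ?] /=;
        rewrite -?val_eqE /= ?mulr1n ?mulr0n ?(phiC h) ?hW ?phik
          ?(fC k2 k1) ?(fC k3) ?o12 ?o13 ?o23 //.
    by rewrite det_diag !big_ord_recl big_ord0 !mxE /= /c0; ring.
  have qc0 : q * c0 != 0 by rewrite mulf_neq0.
  have s0 : s != 0.
    by apply: contraNneq qc0 => s0; rewrite gramE s0 expr0n mul0r.
  have delta0 : delta != 0.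
    by apply: contraNneq qc0 => d0; rewrite gramE d0 mulr0.
  have := congr1 v gramE; rewrite (vM HF) // (vM HF) ?expf_neq0 // (vX2 HF) //.
  have [n bE] := fractional_ideal_ball HF Hb.
  have [na [aE na01]] : exists na, a = ball v na /\ (na = 0 \/ na = 1).
    by case: Ha => ->; [exists 0|exists 1]; split=> //; [left|right].
  move: Hab; rewrite aE bE (principal_ball HF) ?mulf_neq0 //.
  rewrite !(ideal_mul_ball HF Hpi) (vM HF) // => /(ball_inj HF Hpi) hv hg.
  congr (ball v _); move: hv hg disc01 na01.
  by move: (v delta) (v q) (v s) (v c0) => d1 d2 d3 d4; clear; lia.
have [iso_hd aniso_hd] := maximal_half_det coordE fE two_neq0 disc_neq0 HF Hpi
  HM bm disc01.
have [_ _ _ dm _] := bm; have [_ _ _ de _] := be.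
have hdE := v_half_det fE HF two_neq0 disc_neq0 dm.
(* In the isotropic case both terms on the right are v(c0); in the anisotropic case they add up to
   2. *)
have [n [cE nE]] : exists n, c = ball v n /\
    2 * n = v (half_det psi m1 m2 m3) + v c0.
  have [iso|aniso] := EM (exists2 w, w != 0 & psi w w = 0).
    have [w w0 fw] := iso; exists (v c0); split; 
      last by rewrite iso_hd // mulr_natl mulr2n.
    rewrite -a_ball; apply: c_split.
    exact: (isotropic_even_clifford_split coordE c1 c2 c3 fE two_neq0 disc_neq0
      HA Hstar w0 fw).
  exists 1; split; last by rewrite aniso_hd // subrK mulr1.
  apply: c_nonsplit => split; apply: aniso.
  exact: (even_clifford_split_isotropic coordE c1 c2 c3 fE two_neq0 disc_neq0
    HA Hstar split).
rewrite volE (lattice_volume_dual coordE c1 c2 c3 fE two_neq0 disc_neq0 HF HA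
  Hstar QLW subLW be).
rewrite (lattice_index_ball kB HF subLW bm be) cE (ideal_mul_ball HF Hpi).
(* What remains is v(2 c0 D(e)) = n + v(D(e)) - v(D(m)), a consequence of [hdE] and [nE]. *)
congr (gmul _ (ball v _) _).
have tc0 : 2%:R * c0 != 0 by rewrite mulf_neq0.
rewrite (vM HF tc0 de) (vM HF two_neq0 disc_neq0).
move: hdE nE; rewrite -/c0.
move: (v (half_det _ _ _ _)) (v c0) (v 2%:R) (v (detk _ _ _ m1 m2 m3)).
by move: (v (detk _ _ _ e1 e2 e3)) => d1 d2 d3 d4 d5; clear; lia.
Qed.
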